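(* Let $p>1$ and let $(\mathcal{X},\mathcal{F},\{\mathcal{F}_n\}_{n\ge0},\mu)$ be a discrete-time filtered probability space. For all $\mathbf{f}\ge0$ and $F\ge\mathbf{f}^p$, $$\widetilde{\mathcal{B}}^{\mathcal{F}}_\mu(F,\mathbf{f})\le\mathcal{B}^{\mathcal{F}}_\mu(F,\mathbf{f},1;1).$$ Moreover, if $\{\mathcal{F}_n\}_{n\ge0}$ is an infinitely refining filtration, then $\widetilde{\mathcal{B}}^{\mathcal{F}}_\mu(F,\mathbf{f})=\mathcal{B}^{\mathcal{F}}_\mu(F,\mathbf{f},1;1)$ (which by the coincidence theorem also equals the dyadic Bellman function $\mathcal{B}(F,\mathbf{f},1;1)$).
   Context: $f_n=\mathbb{E}^\mu[f\mid\mathcal{F}_n]$, $f^*=\sup_{n\ge0}|f_n|$. $\widetilde{\mathcal{B}}^{\mathcal{F}}_\mu(F,\mathbf{f})=\sup\{\mathbb{E}^\mu[|f^*|^p]: f\ge0,\ \mathbb{E}^\mu[f^p]=F,\ \mathbb{E}^\mu[f]=\mathbf{f}\}$. $\mathcal{B}^{\mathcal{F}}_\mu(F,\mathbf{f},M;C)$ is the supremum of $\mathbb{E}^\mu[\sum_{n\ge0}\alpha_nf_n^p]$ over all non-negative $f$ and all sequences of non-negative random variables $\{\alpha_n\}$ with $\alpha_n$ $\mathcal{F}_n$-measurable and $\mathbb{E}^\mu[\sum_{k\ge n}\alpha_k\mid\mathcal{F}_n]\le C$ for all $n$, such that $\mathbb{E}^\mu[f^p]=F$, $\mathbb{E}^\mu[f]=\mathbf{f}$,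 $\mathbb{E}^\mu[\sum_n\alpha_n]=M$. The dyadic Bellman function $\mathcal{B}(F,\mathbf{f},M;C)$ is the supremum of $|I|^{-1}\sum_{J\in\mathcal{D},J\subseteq I}\alpha_J\langle f\rangle_J^p$ over non-negative $f$ on a dyadic interval $I$ and non-negative $\{\alpha_J\}$ with $\langle f^p\rangle_I=F$, $\langle f\rangle_I=\mathbf{f}$, $|I|^{-1}\sum_{J\subseteq I}\alpha_J=M$, $\sum_{J'\subseteq J}\alpha_{J'}\le C|J|$ for all dyadic $J\subseteq I$. The filtration is infinitely refining if for every $\varepsilon>0$, $n\ge0$, $E\in\mathcal{F}_n$ there exist $k>n$ and real-valued $\mathcal{F}_k$-measurable $h$ with $|h\mathbf{1}_E|=\mathbf{1}_E$ and $\int_E|\mathbb{E}^\mu[h\mid\mathcal{F}_n]|\,d\mu\le\varepsilon$. *)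

(* Defs.v *)
From HB Require Import structures.
From mathcomp Require Import all_boot all_order all_algebra.
From mathcomp Require Import all_classical all_reals all_analysis.
From mathcomp Require Import measurable_realfun.
Set Implicit Arguments. Unset Strict Implicit. Unset Printing Implicit Defensive.
Import Order.TTheory GRing.Theory Num.Theory.
Import numFieldNormedType.Exports.
Local Open Scope classical_set_scope.
Local Open Scope ring_scope.

Definition G_measurable {d} {T : measurableType d} {R : realType}
  (G : set (set T)) (g : T -> \bar R) : Prop :=
  forall B : set (\bar R), measurable B -> G (g @^-1` B).

Definition filtration {d} {T : measurableType d} (F : nat -> set (set T)) : Prop :=
  forall n, [/\ sigma_algebra setT (F n), F n `<=` measurable & F n `<=` F n.+1].

Definition is_condexp {d} {T : measurableType d} {R : realType}
  (mu : {measure set T -> \bar R}) (G : set (set T)) (h g : T -> \bar R) : Prop :=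
  G_measurable G g /\
  forall A, G A -> (\int[mu]_(x in A) g x = \int[mu]_(x in A) h x)%E.

Definition cond_exps {d} {T : measurableType d} {R : realType}
  (mu : {measure set T -> \bar R}) (F : nat -> set (set T))
  (f : T -> R) (fn : nat -> T -> R) : Prop :=
  forall n, is_condexp mu (F n) (EFin \o f) (EFin \o fn n) /\
            mu.-integrable setT (EFin \o fn n).

Definition maxfun {T} {R : realType} (fn : nat -> T -> R) (x : T) : \bar R :=
  ereal_sup (range (fun n => (`|fn n x|)%:E)).

Definition Btilde {d} {T : measurableType d} {R : realType}
  (mu : probability T R) (F : nat -> set (set T)) (p Fv fv : R) : \bar R :=
  ereal_sup [set v | exists (f : T -> R) (fn : nat -> T -> R),
    [/\ [/\ measurable_fun setT f, (forall x, 0 <= f x),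
            (\int[mu]_x ((f x) `^ p)%:E = Fv%:E)%E &
            (\int[mu]_x (f x)%:E = fv%:E)%E],
        cond_exps mu F f fn &
        v = (\int[mu]_x (maxfun fn x `^ p))%E]].

Definition Bmart {d} {T : measurableType d} {R : realType}
  (mu : probability T R) (F : nat -> set (set T)) (p Fv fv M C : R) : \bar R :=
  ereal_sup [set v | exists (f : T -> R) (fn : nat -> T -> R) (alpha : nat -> T -> R),
    [/\ [/\ measurable_fun setT f, (forall x, 0 <= f x),
            (\int[mu]_x ((f x) `^ p)%:E = Fv%:E)%E,
            (\int[mu]_x (f x)%:E = fv%:E)%E &
            cond_exps mu F f fn],
        (forall n x, 0 <= alpha n x) /\
        (forall n, G_measurable (F n) (EFin \o alpha n)),
        (forall n, exists g : T -> \bar R,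
            [/\ is_condexp mu (F n) (fun x => (\sum_(n <= k <oo) (alpha k x)%:E)%E) g,
                (forall x, (0 <= g x)%E) &
                {ae mu, forall x, (g x <= C%:E)%E}]),
        (\int[mu]_x (\sum_(k <oo) (alpha k x)%:E) = M%:E)%E &
        v = (\int[mu]_x (\sum_(k <oo) ((alpha k x) * (fn k x `^ p))%:E))%E]].

Definition inf_refining {d} {T : measurableType d} {R : realType}
  (mu : probability T R) (F : nat -> set (set T)) : Prop :=
  forall (eps : R) (n : nat) (E : set T), 0 < eps -> F n E ->
  exists (k : nat) (h : T -> R),
    [/\ (n < k)%N, G_measurable (F k) (EFin \o h),
        mu.-integrable setT (EFin \o h),
        (forall x, `|h x * \1_E x| = \1_E x) &
        exists g : T -> R,
          [/\ is_condexp mu (F n) (EFin \o h) (EFin \o g),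
              mu.-integrable setT (EFin \o g) &
              (\int[mu]_(x in E) (`|g x|)%:E <= eps%:E)%E]].

(* dyadic intervals of [0,1): J_{m,j} = [j 2^-m, (j+1) 2^-m), j < 2^m *)
Definition dyad {R : realType} (m j : nat) : set R :=
  [set x : R | (j%:R / 2 ^+ m <= x) && (x < j.+1%:R / 2 ^+ m)].

Definition dyavg {R : realType} (f : R -> R) (m j : nat) : \bar R :=
  ((2 ^+ m)%:E * \int[lebesgue_measure]_(x in dyad m j) (f x)%:E)%E.

(* sum of alpha_{J'} over dyadic J' contained in J_{m,j} *)
Definition dsub {R : realType} (alpha : nat -> nat -> R) (m j : nat) : \bar R :=
  (\sum_(m <= m' <oo) \sum_(j' < 2 ^ m' | (j' %/ 2 ^ (m' - m) == j)%N)
      (alpha m' j')%:E)%E.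

Definition Bdyadic {R : realType} (p Fv fv M C : R) : \bar R :=
  ereal_sup [set v | exists (f : R -> R) (alpha : nat -> nat -> R),
    [/\ [/\ measurable_fun (dyad 0 0) f, (forall x, dyad 0 0 x -> 0 <= f x),
            (\int[lebesgue_measure]_(x in dyad 0 0) ((f x) `^ p)%:E = Fv%:E)%E &
            (\int[lebesgue_measure]_(x in dyad 0 0) (f x)%:E = fv%:E)%E],
        (forall m j, 0 <= alpha m j),
        (\sum_(m <oo) \sum_(j < 2 ^ m) (alpha m j)%:E = M%:E)%E,
        (forall m j, (j < 2 ^ m)%N -> (dsub alpha m j <= (C / 2 ^+ m)%:E)%E) &
        v = (\sum_(m <oo) \sum_(j < 2 ^ m) ((alpha m j)%:E * (dyavg f m j `^ p)))%E]].

(* Main.v *)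
Require Import Defs.
From HB Require Import structures.
From mathcomp Require Import all_boot all_order all_algebra.
From mathcomp Require Import all_classical all_reals all_analysis.
From mathcomp Require Import measurable_realfun.
From mathcomp Require Import ring lra.
Import Order.TTheory GRing.Theory Num.Theory.
Import numFieldNormedType.Exports.
Local Open Scope classical_set_scope.
Local Open Scope ring_scope.
Set Implicit Arguments. Unset Strict Implicit. Unset Printing Implicit Defensive.

(* The first inequality and its converse hold on every filtration.  For "at
   most", take [alpha_k = E (1_(E_k) | F_k)], where [E_k] is the event that
   [max (f_0, ..., f_N)] is first attained at time [k], and let [N] tend to
   infinity.  For "at least", sum by parts against the increments of [M_n^p],
   where [M_n] is the running maximum, and use
   [E (sum_(k >= n) alpha_k | F_n) <= 1].

   On an infinitely refining filtration the value depends only on [F] and [f]: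
   writing [F = f^p (1 - a)^p / (1 - a p)] with [0 <= a < 1/p], it is
   [f^p / (1 - a p)].  "At most" is Doob's argument for the running maximum
   started at [f], closed by Young's inequality with parameter [1 - a].  For "at
   least", a decreasing chain of sets [E_0, E_1, ...], in which [E_j] minus
   [E_(j+1)] takes up the proportion [s] of [E_j] almost uniformly with respect
   to the past, plays the role of the intervals [(0, t]]: the extremal function
   carries on it the local means of [f (1 - a) t^(-a)], whose mean over [(0, t]]
   is [f t^(-a)].  By Jensen's inequality its p-th moment is only at most [F];
   mixing in a little of a function concentrated on a small set raises the
   moment to [F] at almost no cost, and then [s] tends to 0.

   The dyadic Bellman function is that of the dyadic filtration of [[0, 1[],
   which is infinitely refining. *)

(** * Powers and integrals *)

Section powR_inequalities.
Variable R : realType.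
Implicit Types p q x y : R.

Lemma ler_powR2r p x y : 0 <= p -> 0 <= x -> x <= y -> x `^ p <= y `^ p.
Proof. by move=> p0 x0 xy; rewrite ge0_ler_powR ?nnegrE//; exact: le_trans xy. Qed.

Lemma lee_poweR2r p (x y : \bar R) : 0 <= p -> (0 <= x)%E -> (x <= y)%E ->
  (x `^ p <= y `^ p)%E.
Proof.
move=> p0 x0 xy; apply: gt0_ler_poweR => //; rewrite in_itv/= leey andbT//.
exact: le_trans xy.
Qed.

Lemma powR_young p x y : 1 < p -> 0 <= x -> 0 <= y ->
  p * (y * x `^ (p - 1)) <= y `^ p + (p - 1) * x `^ p.
Proof.
move=> p1 x0 y0.
have p0 : 0 < p by lra.
have p10 : 0 < p - 1 by lra.
have q0 : 0 < p / (p - 1) by rewrite divr_gt0.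
have p_conj : p^-1 + (p / (p - 1))^-1 = 1 by field; rewrite !gt_eqF.
have := conjugate_powR y0 (powR_ge0 x (p - 1)) p0 q0 p_conj.
rewrite -powRrM mulrCA divff ?gt_eqF// mulr1 -(ler_pM2l p0) => /le_trans; apply.
by rewrite le_eqVlt; apply/orP; left; apply/eqP; field; rewrite !gt_eqF.
Qed.

Lemma powR_bernoulli p y : 1 < p -> 0 <= y -> 1 + p * (y - 1) <= y `^ p.
Proof. by move=> p1 /(powR_young p1 ler01); rewrite !powR1; lra. Qed.

Lemma powR_tangent p x y : 1 < p -> 0 <= x -> 0 <= y ->
  p * x `^ (p - 1) * (y - x) <= y `^ p - x `^ p.
Proof.
move=> p1 x0 y0; have := powR_young p1 x0 y0.
have <- : x * x `^ (p - 1) = x `^ p by rewrite mulr_powRB1//; lra.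
by lra.
Qed.

Lemma powR_concave_tangent q x y : 0 < q <= 1 -> 0 < x -> 0 <= y ->
  y `^ q - x `^ q <= q * x `^ (q - 1) * (y - x).
Proof.
move=> /andP[q0]; rewrite le_eqVlt => /predU1P[->|q1] x0 y0.
  by rewrite !powRr1 ?(ltW x0)// subrr powRr0 !mul1r.
have qV1 : 1 < q^-1 by rewrite invf_gt1.
have := powR_tangent qV1 (powR_ge0 x q) (powR_ge0 y q).
rewrite -!powRrM divff ?gt_eqF// !powRr1 ?(ltW x0)//.
rewrite (mulrBr q) mulr1 divff ?gt_eqF// => tangent.
have -> : x `^ (q - 1) = (x `^ (1 - q))^-1 by rewrite -powRN opprB.
have xq0 : 0 < x `^ (1 - q) by exact: powR_gt0.
rewrite mulrAC ler_pdivlMr// -[leLHS](mulVKf (lt0r_neq0 q0)) ler_pM2l//.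
by rewrite mulrA mulrAC.
Qed.

Lemma powR_mulrD1 q x : 0 < x -> x `^ q * x = x `^ (1 + q).
Proof.
move=> x0; rewrite powRD; last by rewrite (gt_eqF x0) implybT.
by rewrite powRr1 ?(ltW x0)// mulrC.
Qed.

Lemma cvg_powR (I : Type) (F : set_system I) (u : I -> R) (p l : R) : Filter F -> 0 < l ->
  u i @[i --> F] --> l -> u i `^ p @[i --> F] --> l `^ p.
Proof.
move=> FF l0 ul; apply: (cvg_comp u (fun y => y `^ p) ul).
suff : {for l, continuous (fun y : R => y `^ p)} by [].
apply/differentiable_continuous/derivable1_diffP.
by have [] := is_derive1_powR p l0.
Qed.

Lemma powR_lt1 p x : 0 < p -> 0 <= x -> x < 1 -> x `^ p < 1.
Proof.
by move=> p0 x0 x1; have := gt0_ltr_powR p0 x0 ler01 x1; rewrite powR1.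
Qed.

End powR_inequalities.

Section ereal_sequences.
Variable R : realType.

Lemma cvg_comp_EFin (I : Type) (F : set_system I) (u : I -> R) (l : R) : Filter F ->
  u i @[i --> F] --> l -> (u i)%:E @[i --> F] --> l%:E.
Proof. by move=> FF ul; apply/fine_cvgP; split; [exact: nearW|exact: ul]. Qed.

(* For [k = +oo] the product is discontinuous only where the limit vanishes, and
   a nondecreasing sequence of nonnegative terms is then identically zero. *)
Lemma nondecreasing_cvgeMr (u : (\bar R)^nat) (l k : \bar R) :
  nondecreasing_seq u -> (forall n, (0 <= u n)%E) -> (0 <= k)%E ->
  u n @[n --> \oo] --> l -> (u n * k)%E @[n --> \oo] --> (l * k)%E.
Proof.
move=> ndu u0 k0 ul.
have u_le n : (u n <= l)%E.
  by apply: (cvge_to_ge ul); near=> m; apply: ndu; near: m; exact: nbhs_infty_ge.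
have [l_eq0|l_neq0] := eqVneq l 0%E.
  have u_eq0 n : u n = 0%E by apply/eqP; rewrite eq_le u0 andbT -l_eq0 u_le.
  by under eq_fun do rewrite u_eq0 mul0e; rewrite l_eq0 mul0e; exact: cvg_cst.
have [->|k_neq0] := eqVneq k 0%E.
  by under eq_fun do rewrite mule0; rewrite mule0; exact: cvg_cst.
apply: cvgeM => //; last exact: cvg_cst.
by move: l_neq0 k_neq0; case: (l) => [r||]; case: (k) => [s||].
Unshelve. all: by end_near. Qed.

End ereal_sequences.

Section measurable_functions.
Context d (T : measurableType d) (R : realType).
Implicit Types (D : set T) (u : T -> R).

Lemma measurable_fun_powR D u p :
  measurable_fun D u -> measurable_fun D (fun x => u x `^ p).
Proof. exact: (measurableT_comp (measurable_powR p)). Qed.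

Lemma measurable_fun_poweR D (u : T -> \bar R) p :
  measurable_fun D u -> measurable_fun D (fun x => (u x `^ p)%E).
Proof. exact: (measurableT_comp (measurable_poweR p)). Qed.

Lemma measurable_nneseries_from (v : nat -> T -> \bar R) n :
  (forall k, measurable_fun setT (v k)) -> (forall k x, (0 <= v k x)%E) ->
  measurable_fun setT (fun x => \sum_(n <= k <oo) v k x)%E.
Proof.
move=> mv v0; apply: (emeasurable_fun_cvg (fun m x => \sum_(n <= k < m) v k x)%E).
- by move=> m; apply: emeasurable_sum.
- by move=> x _; apply: is_cvg_nneseries => k _ _.
Qed.

End measurable_functions.

Section nonnegative_integrals.
Context d (T : measurableType d) (R : realType).
Variable mu : {measure set T -> \bar R}.
Implicit Types (D : set T) (u v : T -> R).

Lemma ge0_integrable D u : measurable_fun D u -> (forall x, 0 <= u x) ->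
  (\int[mu]_(x in D) (u x)%:E < +oo)%E -> mu.-integrable D (EFin \o u).
Proof.
move=> mu_ u0 int_u; apply/integrableP; split; first exact/measurable_EFinP.
by under eq_integral do rewrite /= ger0_norm//.
Qed.

Lemma ge0_le_integral_EFin D u v : measurable D -> measurable_fun D u ->
  measurable_fun D v -> (forall x, 0 <= u x <= v x) ->
  (\int[mu]_(x in D) (u x)%:E <= \int[mu]_(x in D) (v x)%:E)%E.
Proof.
move=> mD mu_ mv uv; apply: ge0_le_integral => //; do ?exact/measurable_EFinP;
  by move=> x _; rewrite lee_fin; have /andP[] := uv x.
Qed.

Lemma ge0_integral_lincomb D (a b : R) u v : measurable D -> 0 <= a -> 0 <= b ->
  measurable_fun D u -> measurable_fun D v ->
  (forall x, 0 <= u x) -> (forall x, 0 <= v x) ->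
  (\int[mu]_(x in D) (a * u x + b * v x)%:E =
   a%:E * \int[mu]_(x in D) (u x)%:E + b%:E * \int[mu]_(x in D) (v x)%:E)%E.
Proof.
move=> mD a0 b0 mu_ mv u0 v0.
rewrite -!ge0_integralZl//; do ?[exact/measurable_EFinP|by move=> x _; rewrite lee_fin].
by rewrite -ge0_integralD//; do ?[by move=> x _; rewrite mule_ge0 ?lee_fin
  |by apply: measurable_funeM; exact/measurable_EFinP].
Qed.

Lemma ge0_integral_nneseries_from D (v : nat -> T -> \bar R) n : measurable D ->
  (forall k, measurable_fun setT (v k)) -> (forall k x, (0 <= v k x)%E) ->
  (\int[mu]_(x in D) (\sum_(n <= k <oo) v k x) =
   \sum_(n <= k <oo) \int[mu]_(x in D) v k x)%E.
Proof.
move=> mD mv v0; under eq_integral do rewrite -nneseries_addn//.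
rewrite integral_nneseries//; last by move=> k; exact: measurable_funTS.
rewrite (@nneseries_addn _ (fun k => \int[mu]_(x in D) v k x)%E)// => k.
exact: integral_ge0.
Qed.

Lemma ge0_integral_setDI D A (h : T -> \bar R) : measurable D -> measurable A ->
  measurable_fun setT h -> (forall x, (0 <= h x)%E) ->
  (\int[mu]_(x in D) h x =
   \int[mu]_(x in D `\` A) h x + \int[mu]_(x in D `&` A) h x)%E.
Proof.
move=> mD mA mh h0; rewrite -ge0_integral_setU//.
- by rewrite setUC setUIDK.
- exact: measurableD.
- exact: measurableI.
- exact: measurable_funTS.
- by apply/disj_set2P; rewrite setDE setIACA setICl setI0.
Qed.

Lemma ge0_integral_mulr_indic D A (h : T -> \bar R) : measurable D ->
  (\int[mu]_(x in D) (h x * (\1_A x)%:E) = \int[mu]_(x in D `&` A) h x)%E.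
Proof.
move=> mD; rewrite [RHS]integral_mkcondr; apply: eq_integral => x _.
by rewrite epatch_indic.
Qed.

End nonnegative_integrals.

Section probability_integrals.
Context d (T : measurableType d) (R : realType) (mu : probability T R).
Implicit Types A B D : set T.
Local Notation pr A := (fine (mu A)).

Lemma integral_cst_prob (c : \bar R) : (\int[mu]_x (cst c x) = c)%E.
Proof.
by rewrite integral_cst// -[RHS]mule1; congr (_ * _)%E; exact: probability_setT.
Qed.

Lemma fine_probK A : measurable A -> (pr A)%:E = mu A.
Proof. by move=> mA; rewrite fineK// fin_num_measure. Qed.

Lemma integral_cst_fine D (c : R) : measurable D ->
  (\int[mu]_(x in D) cst c%:E x = (c * pr D)%:E)%E.
Proof. by move=> mD; rewrite integral_cst// EFinM fine_probK. Qed.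

Lemma integral_indic_fine D A : measurable D -> measurable A ->
  (\int[mu]_(x in D) (\1_A x)%:E = (pr (A `&` D))%:E)%E.
Proof. by move=> mD mA; rewrite integral_indic// fine_probK//; exact: measurableI. Qed.

Lemma fine_prob_setT : pr setT = 1.
Proof. by rewrite [mu _]probability_setT. Qed.

Lemma fine_prob_setD A B : measurable A -> measurable B -> B `<=` A ->
  pr (A `\` B) = pr A - pr B.
Proof.
move=> mA mB BA; rewrite measureD// ?fin_num_measure//; last first.
  by rewrite -ge0_fin_numE// fin_num_measure.
by rewrite (setIidr BA) fineB// fin_num_measure.
Qed.

Lemma le_fine_prob A B : measurable A -> measurable B -> A `<=` B -> pr A <= pr B.
Proof.
by move=> mA mB AB; apply: fine_le; rewrite ?fin_num_measure// le_measure ?inE.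
Qed.

End probability_integrals.

(** * Conditional expectation *)

Section integral_of_products.
Context d (T : measurableType d) (R : realType).
Variable mu : {measure set T -> \bar R}.
Implicit Types k Y : T -> \bar R.

Import HBNNSimple.

Lemma ge0_integral_fimfunM (f : {fimfun T >-> R}) k :
  (forall x, 0 <= f x) -> (forall r, measurable (f @^-1` [set r])) ->
  measurable_fun setT k -> (forall x, (0 <= k x)%E) ->
  (\int[mu]_x ((f x)%:E * k x) =
   \sum_(r \in range f) r%:E * \int[mu]_(x in f @^-1` [set r]) k x)%E.
Proof.
move=> f0 mf mk k0.
have level_ge0 r x : (0 <= (r * \1_(f @^-1` [set r]) x)%:E)%E.
  rewrite lee_fin indicE; case: (boolP (x \in _)) => [/set_mem/= <-|_].
    by rewrite mulr1.
  by rewrite mulr0.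
transitivity (\int[mu]_x (\sum_(r \in range f)
    (r * \1_(f @^-1` [set r]) x)%:E * k x))%E.
  apply: eq_integral => x _; rewrite -ge0_mule_fsuml//.
  by congr (_ * _)%E; rewrite fsumEFin//; congr EFin; exact: (fimfunE f x).
rewrite ge0_integral_fsum//; last 2 first.
- move=> r; apply: emeasurable_funM => //; apply/measurable_EFinP.
  by apply: measurable_funM => //; exact: measurable_indic.
- by move=> r x _; rewrite mule_ge0.
apply: eq_fsbigr => r /set_mem[x0 _ <-].
under eq_integral do rewrite EFinM -muleA.
rewrite ge0_integralZl ?lee_fin//.
- under eq_integral do rewrite muleC.
  by rewrite ge0_integral_mulr_indic// setTI.
- by apply: emeasurable_funM => //; exact/measurable_EFinP/measurable_indic.
- by move=> x _; rewrite mule_ge0// lee_fin.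
Qed.

Lemma nondecreasing_integralM (u : (T -> R)^nat) Y k :
  (forall n, measurable_fun setT (u n)) -> (forall n x, 0 <= u n x) ->
  (forall x, nondecreasing_seq (u ^~ x)) ->
  (forall x, (u n x)%:E @[n --> \oo] --> Y x) ->
  measurable_fun setT k -> (forall x, (0 <= k x)%E) ->
  (\int[mu]_x (Y x * k x) = limn (fun n => \int[mu]_x ((u n x)%:E * k x)))%E.
Proof.
move=> mu_ u0 ndu uY mk k0; rewrite -monotone_convergence//.
- apply: eq_integral => x _; apply/esym/cvg_lim => //.
  apply: nondecreasing_cvgeMr => // [m n mn|n]; last by rewrite lee_fin.
  by rewrite lee_fin ndu.
- by move=> n; apply: emeasurable_funM => //; exact/measurable_EFinP.
- by move=> n x _; rewrite mule_ge0 ?lee_fin.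
- by move=> x _ m n mn; rewrite lee_wpmul2r// lee_fin ndu.
Qed.

End integral_of_products.

Section sub_sigma_algebra.
Context d (T : measurableType d) (R : realType).
Variable G : set (set T).
Hypotheses (sG : sigma_algebra setT G) (Gm : G `<=` measurable).
Local Notation TG := (g_sigma_algebraType G).
Implicit Types (A B : set T) (g h Y : T -> \bar R) (u X : T -> R).

Lemma measurable_subsigmaE : @measurable _ TG = G.
Proof. exact: sigma_algebra_id. Qed.

Lemma G_measurable_set A : @measurable _ TG A -> G A.
Proof. by rewrite measurable_subsigmaE. Qed.

Lemma G_measurableP g : G_measurable G g <-> @measurable_fun _ _ TG _ setT g.
Proof.
split=> [mg _ B mB|mg B mB]; first by rewrite setTI measurable_subsigmaE; exact: mg.
have := mg measurableT B mB; rewrite setTI measurable_subsigmaE; exact.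
Qed.

Lemma G_measurable_EFinP u :
  G_measurable G (EFin \o u) <-> @measurable_fun _ _ TG _ setT u.
Proof.
split=> [/G_measurableP/measurable_EFinP//|mu]; apply/G_measurableP.
exact/measurable_EFinP.
Qed.

Lemma measurable_fun_id_subsigma : @measurable_fun _ _ T TG setT id.
Proof. by move=> _ A; rewrite measurable_subsigmaE setTI => /Gm. Qed.

Lemma G_measurableW g : G_measurable G g -> measurable_fun setT g.
Proof. by move=> mg _ B mB; rewrite setTI; apply: Gm; exact: mg. Qed.

Lemma G_measurable_EFinW u : G_measurable G (EFin \o u) -> measurable_fun setT u.
Proof. by move=> /G_measurableW/measurable_EFinP. Qed.

Lemma G_setT : G setT.
Proof. by rewrite -measurable_subsigmaE; exact: measurableT. Qed.

Lemma G_setI A B : G A -> G B -> G (A `&` B).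
Proof. by rewrite -measurable_subsigmaE => mA mB; exact: measurableI. Qed.

Lemma G_setD A B : G A -> G B -> G (A `\` B).
Proof. by rewrite -measurable_subsigmaE => mA mB; exact: measurableD. Qed.

Lemma G_set_lt u X : G_measurable G (EFin \o u) -> G_measurable G (EFin \o X) ->
  G [set x | u x < X x].
Proof.
move=> /G_measurableP mu /G_measurableP mX; rewrite -measurable_subsigmaE.
by have := @measurable_lte _ TG R setT measurableT _ _ mu mX; rewrite setTI.
Qed.

Section pullout.
Import HBNNSimple.

Lemma condexp_pullout (mu : {measure set T -> \bar R}) g h Y :
  measurable_fun setT h -> (forall x, (0 <= h x)%E) -> (forall x, (0 <= g x)%E) ->
  is_condexp mu G h g -> G_measurable G Y -> (forall x, (0 <= Y x)%E) ->
  (\int[mu]_x (Y x * g x) = \int[mu]_x (Y x * h x))%E.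
Proof.
move=> mh h0 g0 [mg gh] /G_measurableP mY Y0.
pose f := @nnsfun_approx _ TG R setT measurableT _ mY.
have Glevel n r : G (f n @^-1` [set r]).
  by apply: G_measurable_set; exact: measurable_sfunP.
have approx k : measurable_fun setT k -> (forall x, (0 <= k x)%E) ->
    (\int[mu]_x (Y x * k x) = limn (fun n => \int[mu]_x ((f n x)%:E * k x)))%E.
  apply: nondecreasing_integralM => [n|n x|x m n mn|x] //.
  - by apply/G_measurable_EFinW/G_measurable_EFinP; exact: measurable_funP.
  - exact/lefP/(@nd_nnsfun_approx _ TG).
  - exact: (@cvg_nnsfun_approx _ TG).
have mgT := G_measurableW mg.
rewrite !approx//; congr (limn _); apply/funext => n.
rewrite !(ge0_integral_fimfunM mu (f := f n))//; do ?by move=> r; exact/Gm/Glevel.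
by apply: eq_fsbigr => r _; rewrite gh//; exact: Glevel.
Qed.

Lemma condexp_adjoint (mu : {measure set T -> \bar R}) (f h g Y : T -> \bar R) :
  measurable_fun setT f -> measurable_fun setT h ->
  (forall x, (0 <= f x)%E) -> (forall x, (0 <= h x)%E) ->
  (forall x, (0 <= g x)%E) -> (forall x, (0 <= Y x)%E) ->
  is_condexp mu G h g -> is_condexp mu G f Y ->
  (\int[mu]_x (Y x * h x) = \int[mu]_x (g x * f x))%E.
Proof.
move=> mf mh f0 h0 g0 Y0 hg fY; rewrite -(condexp_pullout mh h0 g0 hg fY.1 Y0).
rewrite -(condexp_pullout mf f0 Y0 fY hg.1 g0).
by apply: eq_integral => x _; rewrite muleC.
Qed.

End pullout.

End sub_sigma_algebra.

Section subsigma_measure.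
Context d (T : measurableType d) (R : realType).
Variables (G : set (set T)) (sG : sigma_algebra setT G) (Gm : G `<=` measurable).
Local Notation TG := (g_sigma_algebraType G).
Variable m : set T -> \bar R.
Hypotheses (m0 : m set0 = 0%E) (m_ge0 : forall A, (0 <= m A)%E).
Hypotheses (m_sigma_additive : semi_sigma_additive m) (m_fin : fin_num_fun m).

Let measurable_TG (A : set T) : @measurable _ TG A -> measurable A.
Proof. by move=> /(G_measurable_set sG)/Gm. Qed.

Let mG : set TG -> \bar R := m.

Let mG_sigma_additive : semi_sigma_additive mG.
Proof.
move=> A mA tA mUA; apply: m_sigma_additive => //; last exact: measurable_TG.
by move=> n; apply: measurable_TG; exact: mA.
Qed.

Let mG_measure : {measure set TG -> \bar R} :=
  HB.pack mG (isMeasure.Build _ TG R mG m0 m_ge0 mG_sigma_additive).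

Let mG_fin : fin_num_fun mG_measure.
Proof. by move=> A /measurable_TG; exact: m_fin. Qed.

(* Packed by hand: a canonical instance on [m] would shadow that of the measure
   it restricts. *)
Definition subsigma_measure : {finite_measure set TG -> \bar R} :=
  HB.pack mG mG_measure (Measure_isFinite.Build _ TG R mG_measure mG_fin).

End subsigma_measure.

Section condexp_existence.
Context d (T : measurableType d) (R : realType).
Variables (G : set (set T)) (sG : sigma_algebra setT G) (Gm : G `<=` measurable).
Variables (mu : probability T R) (h : T -> \bar R).
Hypotheses (hi : mu.-integrable setT h) (h0 : forall x, (0 <= h x)%E).
Local Notation TG := (g_sigma_algebraType G).

Let nu (A : set T) : \bar R := (\int[mu]_(x in A) h x)%E.

Let nu_ge0 A : (0 <= nu A)%E. Proof. exact: integral_ge0. Qed.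

Let nu_sigma_additive : semi_sigma_additive nu.
Proof.
move=> A mA tA mUA; apply: semi_sigma_additive_nng_induced => //.
exact: measurable_int hi.
Qed.

Let nu_fin : fin_num_fun nu.
Proof. by move=> A mA; apply: integrable_fin_num => //; exact: integrableS hi. Qed.

Let muG := subsigma_measure sG Gm (measure0 mu) (measure_ge0 mu)
  (@measure_semi_sigma_additive _ _ _ mu) (@fin_num_measure _ _ _ mu).

Let nuG := subsigma_measure sG Gm (integral_set0 mu h) nu_ge0 nu_sigma_additive nu_fin.

Lemma condexp_exists :
  exists X : T -> R, [/\ is_condexp mu G h (EFin \o X),
    mu.-integrable setT (EFin \o X) & forall x, 0 <= X x].
Proof.
have nu_dom : nuG `<< muG.
  apply/null_content_dominatesP => A /(G_measurable_set sG)/Gm mA A0.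
  rewrite -[LHS]/(nu A); apply: null_set_integral => //.
  by apply: measurable_funTS; exact: measurable_int hi.
have [f [f0 ffin fint fE]] := radon_nikodym_sigma_finite nu_dom.
have Ef : EFin \o (fine \o f) = f by apply/funext => x /=; rewrite fineK.
have Gf : G_measurable G (f : T -> \bar R).
  by apply/G_measurableP => //; exact: measurable_int fint.
have intE A : G A -> (\int[mu]_(x in A) f x = \int[mu]_(x in A) h x)%E.
  move=> GA; have mA : @measurable _ TG A by rewrite measurable_subsigmaE.
  rewrite -[RHS]/(nuG A) fE//.
  have mfA : @measurable_fun _ _ TG _ A f.
    by apply: measurable_funTS; exact/G_measurableP.
  by have /esym := ge0_integral_pushforward (measurable_fun_id_subsigma sG Gm) mu mA mfA
    (fun x _ => f0 x).
exists (fine \o f); rewrite Ef; split => //.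
- apply/integrableP; split; first exact: G_measurableW Gf.
  under eq_integral do rewrite gee0_abs//.
  rewrite intE; last exact: G_setT.
  by rewrite ltey_eq integrable_fin_num.
- by move=> x; rewrite fine_ge0.
Qed.

End condexp_existence.

Section condexp_theory.
Context d (T : measurableType d) (R : realType).
Variables (G : set (set T)) (sG : sigma_algebra setT G) (Gm : G `<=` measurable).
Variable mu : probability T R.
Implicit Types (h : T -> \bar R) (f g X Y : T -> R).

Lemma ae_le_integral_subsigma X Y :
  G_measurable G (EFin \o X) -> G_measurable G (EFin \o Y) ->
  mu.-integrable setT (EFin \o X) -> mu.-integrable setT (EFin \o Y) ->
  (forall A, G A -> (\int[mu]_(x in A) (X x)%:E <= \int[mu]_(x in A) (Y x)%:E)%E) ->
  {ae mu, forall x, X x <= Y x}.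
Proof.
move=> GX GY iX iY le_int; pose A := [set x | Y x < X x].
have GA : G A by exact: G_set_lt.
have mA := Gm GA.
have iXA : mu.-integrable A (EFin \o X) by exact: integrableS iX.
have iYA : mu.-integrable A (EFin \o Y) by exact: integrableS iY.
have mXY : measurable_fun A (fun x => (X x - Y x)%:E).
  by apply: measurable_int (integrableB mA iXA iYA).
have int_eq0 : (\int[mu]_(x in A) `|(X x - Y x)%:E| = 0)%E.
  apply/eqP; rewrite eq_le integral_ge0// andbT.
  rewrite (eq_integral (fun x => (X x)%:E - (Y x)%:E))%E; last first.
    by move=> x /[!inE] Ax; rewrite gee0_abs// lee_fin subr_ge0 ltW.
  rewrite (integralB mA iXA iYA) leeBlDr ?add0e ?le_int//.
  exact: integrable_fin_num.
apply: filterS ((ae_eq_integral_abs mu mA mXY).1 int_eq0) => x /= eq0.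
rewrite leNgt; apply/negP => Ax; move: (eq0 Ax) => -[] /eqP.
by rewrite subr_eq0 => /eqP XY; move: Ax; rewrite XY ltxx.
Qed.

Lemma condexp_ae_ge0 h X : (forall x, (0 <= h x)%E) ->
  is_condexp mu G h (EFin \o X) -> mu.-integrable setT (EFin \o X) ->
  {ae mu, forall x, 0 <= X x}.
Proof.
move=> h0 [GX Xh] iX; apply: (@ae_le_integral_subsigma (cst 0) X) => //.
- by apply/G_measurable_EFinP => //; exact: measurable_cst.
- exact: integrable0.
- by move=> A GA; rewrite integral0 Xh ?integral_ge0.
Qed.

Lemma condexp_abs h X : (forall x, (0 <= h x)%E) ->
  is_condexp mu G h (EFin \o X) -> mu.-integrable setT (EFin \o X) ->
  is_condexp mu G h (fun x => (`|X x|)%:E).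
Proof.
move=> h0 hX iX; have [GX Xh] := hX.
have GnX : G_measurable G (fun x => (`|X x|)%:E).
  apply/(G_measurable_EFinP sG); apply: measurableT_comp => //.
  exact/(G_measurable_EFinP sG).
split => // A GA; rewrite -Xh//; apply: ae_eq_integral.
- exact: Gm.
- by apply: measurable_funTS; exact: G_measurableW GnX.
- by apply: measurable_funTS; exact: G_measurableW GX.
- by apply: filterS (condexp_ae_ge0 h0 hX iX) => x X0 _; rewrite /= ger0_norm.
Qed.

Lemma condexp_lincomb (a b : R) f g X Y :
  mu.-integrable setT (EFin \o f) -> mu.-integrable setT (EFin \o g) ->
  mu.-integrable setT (EFin \o X) -> mu.-integrable setT (EFin \o Y) ->
  is_condexp mu G (EFin \o f) (EFin \o X) -> is_condexp mu G (EFin \o g) (EFin \o Y) ->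
  is_condexp mu G (fun x => (a * f x + b * g x)%:E) (fun x => (a * X x + b * Y x)%:E).
Proof.
move=> iff ig iX iY [GX Xf] [GY Yg]; split.
  apply/(G_measurable_EFinP sG).
  by apply: measurable_funD; apply: measurable_funM => //; exact/(G_measurable_EFinP sG).
move=> A GA; have mA := Gm GA.
have int_lincomb u v : mu.-integrable setT (EFin \o u) -> mu.-integrable setT (EFin \o v) ->
    (\int[mu]_(x in A) (a * u x + b * v x)%:E =
     a%:E * \int[mu]_(x in A) (u x)%:E + b%:E * \int[mu]_(x in A) (v x)%:E)%E.
  move=> /(integrableS measurableT mA (@subsetT _ _)) iu.
  move=> /(integrableS measurableT mA (@subsetT _ _)) iv.
  rewrite -!integralZl// -integralD//; exact: integrableZl.
by rewrite !int_lincomb//; congr (_ * _ + _ * _)%E; [exact: Xf|exact: Yg].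
Qed.

End condexp_theory.

(** * Maximal functions and Carleson sequences *)

Section running_max.
Context (R : realType) (T : Type).
Implicit Types (c : R) (u : nat -> T -> R).

Definition running_max c u n x : R := \big[Num.max/c]_(i < n) u i x.

Lemma running_max0 c u x : running_max c u 0 x = c.
Proof. by rewrite /running_max big_ord0. Qed.

Lemma running_max_ge c u n x : c <= running_max c u n x.
Proof. exact: bigmax_ge_id. Qed.

Lemma le_running_max c u i n x : (i < n)%N -> u i x <= running_max c u n x.
Proof. by move=> ni; exact: (le_bigmax _ (fun i : 'I_n => u i x) (Ordinal ni)). Qed.

Lemma running_max_homo c u x :
  {homo running_max c u ^~ x : m n / (m <= n)%N >-> m <= n}.
Proof.
move=> m n mn; apply/bigmax_leP; split=> [|i _]; first exact: running_max_ge.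
by apply: le_running_max; exact: leq_trans mn.
Qed.

Lemma running_maxS c u n x :
  running_max c u n.+1 x = Num.max (running_max c u n x) (u n x).
Proof.
apply/eqP; rewrite eq_le ge_max running_max_homo// le_running_max// !andbT.
apply/bigmax_leP; split=> [|i _]; first by rewrite le_max running_max_ge.
have := ltn_ord i; rewrite ltnS leq_eqVlt le_max => /predU1P[->|ni].
  by rewrite lexx orbT.
by rewrite le_running_max.
Qed.

End running_max.

Lemma measurable_running_max d (T : measurableType d) (R : realType) (c : R)
    (u : nat -> T -> R) n :
  (forall i, (i < n)%N -> measurable_fun setT (u i)) ->
  measurable_fun setT (running_max c u n).
Proof.
elim: n => [|n IHn] mu.
  rewrite (_ : running_max _ _ _ = cst c); first exact: measurable_cst.
  by apply/funext => x; exact: running_max0.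
rewrite (_ : running_max _ _ _ = fun x => Num.max (running_max c u n x) (u n x)).
  apply: measurable_maxr; last exact: mu.
  by apply: IHn => i ni; apply: mu; exact: ltnW.
by apply/funext => x; exact: running_maxS.
Qed.

Section maximal_function.
Context d (T : measurableType d) (R : realType).
Implicit Types (u v : nat -> T -> R) (p : R).

Lemma maxfun_ge u n x : ((`|u n x|)%:E <= maxfun u x)%E.
Proof. by rewrite /maxfun; apply: ereal_sup_ubound; exists n. Qed.

Lemma maxfun_ge0 u x : (0 <= maxfun u x)%E.
Proof. by apply: le_trans (maxfun_ge u 0 x); rewrite lee_fin. Qed.

Lemma running_max_le_maxfun u n x : ((running_max 0 u n x)%:E <= maxfun u x)%E.
Proof.
elim: n => [|n IHn]; first by rewrite running_max0 maxfun_ge0.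
rewrite running_maxS EFin_max ge_max IHn/=.
by apply: le_trans (maxfun_ge u n x); rewrite lee_fin ler_norm.
Qed.

Lemma maxfun_abs u : maxfun (fun n x => `|u n x|) = maxfun u.
Proof.
by apply/funext => x; rewrite /maxfun; under eq_fun do rewrite normr_id.
Qed.

Lemma maxfun_leP u x (b : \bar R) :
  (maxfun u x <= b)%E <-> forall n, ((`|u n x|)%:E <= b)%E.
Proof.
split=> [ub n|ub]; first exact: le_trans (maxfun_ge u n x) ub.
by apply: ge_ereal_sup => _ [n _ <-].
Qed.

Lemma measurable_maxfun u : (forall n, measurable_fun setT (u n)) ->
  measurable_fun setT (maxfun u).
Proof.
move=> mu; have mnu n : measurable_fun setT (fun x => (`|u n x|)%:E).
  by apply/measurable_EFinP; exact: measurableT_comp.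
rewrite (_ : maxfun u = fun x => esups (fun n => (`|u n x|)%:E) 0).
  exact: (@measurable_fun_esups _ _ _ _ (fun n x => (`|u n x|)%:E)).
apply/funext => x; congr ereal_sup.
by apply/seteqP; split => [_ [n _ <-]|_ [n _ <-]]; exists n.
Qed.

Lemma poweR_maxfun_le u p x (b : \bar R) : 0 < p ->
  (forall n, ((`|u n x| `^ p)%:E <= b)%E) -> (maxfun u x `^ p <= b)%E.
Proof.
move=> p0 ub; have p_ge0 := ltW p0.
have pV0 : 0 <= p^-1 by rewrite invr_ge0.
have b0 : (0 <= b)%E by apply: le_trans (ub 0%N); rewrite lee_fin powR_ge0.
rewrite -[leRHS]poweRe1// -(mulVf (lt0r_neq0 p0)) poweRrM.
apply: lee_poweR2r; rewrite ?maxfun_ge0//; apply/maxfun_leP => n.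
rewrite -[leLHS]poweRe1 ?lee_fin// -(mulfV (lt0r_neq0 p0)) poweRrM.
by apply: lee_poweR2r; rewrite ?poweR_EFin ?lee_fin ?powR_ge0.
Qed.

(* [v] may be any sequence increasing to [maxfun u], such as its running
   maxima, truncated or not. *)
Lemma integral_maxfun_le (mu : {measure set T -> \bar R}) u v p (b : \bar R) :
  0 < p -> (forall n, measurable_fun setT (u n)) ->
  (forall n, measurable_fun setT (v n)) -> (forall n x, 0 <= v n x) ->
  (forall x, nondecreasing_seq (v ^~ x)) ->
  (forall n x, exists m, `|u n x| <= v m x) ->
  (forall n, (\int[mu]_x (v n x `^ p)%:E <= b)%E) ->
  (\int[mu]_x (maxfun u x `^ p) <= b)%E.
Proof.
move=> p0 mu_ mv v0 ndv uv vb; have p_ge0 := ltW p0.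
have mvp n : measurable_fun setT (fun x => (v n x `^ p)%:E).
  by apply/measurable_EFinP; exact: measurable_fun_powR.
have vp0 n x : (0 <= (v n x `^ p)%:E)%E by rewrite lee_fin powR_ge0.
have ndvp x : {homo (fun n => (v n x `^ p)%:E) : m n / (m <= n)%N >-> (m <= n)%E}.
  by move=> m n mn; rewrite lee_fin ler_powR2r// ndv.
have cvgvp x : cvgn (fun n => (v n x `^ p)%:E) by exact: ereal_nondecreasing_is_cvgn.
apply: (@le_trans _ _ (\int[mu]_x limn (fun n => (v n x `^ p)%:E))%E).
  apply: ge0_le_integral => //.
  - by move=> x _; exact: poweR_ge0.
  - by apply: measurable_fun_poweR; exact: measurable_maxfun.
  - by apply: (emeasurable_fun_cvg (fun n x => (v n x `^ p)%:E)) => // x _; exact: cvgvp.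
  - move=> x _; apply: poweR_maxfun_le => // n; have [m unv] := uv n x.
    apply: (@le_trans _ _ (v m x `^ p)%:E); first by rewrite lee_fin ler_powR2r.
    by apply: lime_ge => //; exists m => // k /= mk; exact: ndvp.
apply: cvge_to_le (cvg_monotone_convergence measurableT mvp _ _) _ => //.
exact: nearW.
Qed.

End maximal_function.

Section adapted_sequences.
Context d (T : measurableType d) (R : realType).
Variables (mu : probability T R) (F : nat -> set (set T)).

Definition nneg_adapted (u : nat -> T -> R) : Prop :=
  (forall n x, 0 <= u n x) /\ (forall n, G_measurable (F n) (EFin \o u n)).

Definition carleson (C : R) (alpha : nat -> T -> R) : Prop :=
  forall n, exists g : T -> \bar R,
    [/\ is_condexp mu (F n) (fun x => (\sum_(n <= k <oo) (alpha k x)%:E)%E) g,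
        (forall x, (0 <= g x)%E) &
        {ae mu, forall x, (g x <= C%:E)%E}].

Definition has_moments (p Fv fv : R) (f : T -> R) : Prop :=
  [/\ measurable_fun setT f, (forall x, 0 <= f x),
      (\int[mu]_x (f x `^ p)%:E = Fv%:E)%E & (\int[mu]_x (f x)%:E = fv%:E)%E].

Hypothesis filF : filtration F.

Lemma filtration_sigma n : sigma_algebra setT (F n).
Proof. by have [] := filF n. Qed.

Lemma filtration_measurable n : F n `<=` measurable.
Proof. by have [] := filF n. Qed.

Lemma filtration_le m n : (m <= n)%N -> F m `<=` F n.
Proof.
move=> mn; rewrite -(subnK mn); elim: (n - m)%N => [//|k IHk] A FA.
by rewrite addSn; have [_ _] := filF (k + m); apply; exact: IHk.
Qed.

Lemma nneg_adapted_measurable u n : nneg_adapted u -> measurable_fun setT (u n).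
Proof. by move=> [_ /(_ n)]; apply: G_measurable_EFinW; exact: filtration_measurable. Qed.

Lemma nneg_adapted_powR u p : nneg_adapted u -> nneg_adapted (fun n x => u n x `^ p).
Proof.
move=> [u0 Gu]; split=> [n x|n]; first exact: powR_ge0.
apply/(G_measurable_EFinP (filtration_sigma n))/measurable_fun_powR.
exact/(G_measurable_EFinP (filtration_sigma n)).
Qed.

Lemma adapted_running_max c u n k : nneg_adapted u -> (n <= k.+1)%N ->
  G_measurable (F k) (EFin \o running_max c u n).
Proof.
move=> [_ Gu] nk; have sF := filtration_sigma k.
apply/(G_measurable_EFinP sF).
apply: (@measurable_running_max _ (g_sigma_algebraType (F k))) => i ni.
apply/(G_measurable_EFinP sF) => B mB; apply: (@filtration_le i); last exact: Gu.
by rewrite -ltnS; exact: leq_trans nk.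
Qed.

Lemma adapted_running_max_measurable c u n : nneg_adapted u ->
  measurable_fun setT (running_max c u n).
Proof.
move=> au; apply: (G_measurable_EFinW (@filtration_measurable n)).
exact: adapted_running_max.
Qed.

Section cond_exps_theory.
Variables (f : T -> R).
Hypothesis f0 : forall x, 0 <= f x.

Let f0E x : (0 <= (EFin \o f) x)%E. Proof. by rewrite lee_fin. Qed.

Lemma cond_exps_exists : mu.-integrable setT (EFin \o f) ->
  exists2 fn, cond_exps mu F f fn & forall n x, 0 <= fn n x.
Proof.
move=> fi; have /choice[fn fnP] n := condexp_exists (filtration_sigma n)
  (@filtration_measurable n) fi f0E.
by exists fn => n; have [] := fnP n.
Qed.

Lemma cond_exps_ge0 fn n : cond_exps mu F f fn -> {ae mu, forall x, 0 <= fn n x}.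
Proof.
move=> /(_ n)[]; apply: condexp_ae_ge0 f0E.
- exact: filtration_sigma.
- exact: filtration_measurable.
Qed.

Lemma cond_exps_abs fn : cond_exps mu F f fn ->
  cond_exps mu F f (fun n x => `|fn n x|).
Proof.
move=> fnE n; have [fnE_n ifn] := fnE n; split.
  exact: (condexp_abs (filtration_sigma n) (@filtration_measurable n) f0E).
exact: (integrable_abse ifn).
Qed.

Lemma cond_exps_adapted fn : cond_exps mu F f fn -> (forall n x, 0 <= fn n x) ->
  nneg_adapted fn.
Proof. by move=> fnE fn0; split=> // n; have [[]] := fnE n. Qed.

End cond_exps_theory.

End adapted_sequences.

Lemma sum_mul_increments (R : comPzRingType) (a r : nat -> R) n : r 0%N = 0 ->
  \sum_(k < n) a k * r k.+1 = \sum_(i < n) (r i.+1 - r i) * \sum_(i <= k < n) a k.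
Proof.
move=> r0; elim: n => [|n IHn]; first by rewrite !big_ord0.
rewrite big_ord_recr IHn [RHS]big_ord_recr /= big_nat1.
rewrite [in RHS](eq_bigr (fun i : 'I_n =>
    (r i.+1 - r i) * (\sum_(i <= k < n) a k) + (r i.+1 - r i) * a n)); last first.
  by move=> i _; rewrite big_nat_recr//= ?mulrDr// ltnW.
rewrite big_split -addrA -mulr_suml -mulrDl mulrC; congr (_ + _ * _).
by rewrite -(big_mkord predT (fun i => r i.+1 - r i)) telescope_sumr// r0; ring.
Qed.

Lemma carlesonP d (T : measurableType d) (R : realType) (mu : probability T R)
    (F : nat -> set (set T)) (C : R) (alpha : nat -> T -> R) :
  filtration F -> 0 <= C -> nneg_adapted F alpha ->
  carleson mu F C alpha <->
  forall n A, F n A ->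
    (\int[mu]_(x in A) (\sum_(n <= k <oo) (alpha k x)%:E) <= (C * fine (mu A))%:E)%E.
Proof.
move=> filF C0 al_adapted; have al0 k x : (0 <= (alpha k x)%:E)%E.
  by rewrite lee_fin; case: al_adapted.
have mal k : measurable_fun setT (fun x => (alpha k x)%:E).
  by apply/measurable_EFinP; exact: (nneg_adapted_measurable filF).
have mtail n : measurable_fun setT (fun x => \sum_(n <= k <oo) (alpha k x)%:E)%E.
  exact: measurable_nneseries_from.
have tail0 n x : (0 <= \sum_(n <= k <oo) (alpha k x)%:E)%E by exact: nneseries_ge0.
split=> [al_carleson n A FA|tail_le n]; have sF := filtration_sigma filF n;
  have mF := @filtration_measurable _ _ F filF n.
  have [g [[Gg gE] g0 gC]] := al_carleson n; have mA := mF _ FA.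
  rewrite -gE// -integral_cst_fine//; apply: ae_ge0_le_integral => //.
  - exact/measurable_funTS/(G_measurableW mF).
  - by apply: filterS gC => x gxC _.
have tail_integrable :
    mu.-integrable setT (fun x => \sum_(n <= k <oo) (alpha k x)%:E)%E.
  apply/integrableP; split => //; under eq_integral do rewrite gee0_abs//.
  by apply: le_lt_trans (tail_le n _ (G_setT sF)) _; rewrite ltry.
have [g [gE ig g0]] := condexp_exists sF mF tail_integrable (tail0 n).
exists (EFin \o g); split => //; apply: (ae_le_integral_subsigma sF mF) => //.
- exact: gE.1.
- by apply/(G_measurable_EFinP sF); exact: measurable_cst.
- exact: finite_measure_integrable_cst.
- by move=> A FA; rewrite [leLHS]gE.2// (integral_cst_fine mu C (mF _ FA)) tail_le.
Qed.

Section carleson_embedding.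
Context d (T : measurableType d) (R : realType).
Variables (mu : probability T R) (F : nat -> set (set T)).
Hypothesis filF : filtration F.
Variables (C : R) (alpha : nat -> T -> R).
Hypotheses (C0 : 0 <= C) (al_adapted : nneg_adapted F alpha).
Hypothesis al_carleson : carleson mu F C alpha.

Let al0 n x : (0 <= (alpha n x)%:E)%E. Proof. by rewrite lee_fin; case: al_adapted. Qed.

Let mal n : measurable_fun setT (EFin \o alpha n).
Proof. by apply/measurable_EFinP; exact: (nneg_adapted_measurable filF). Qed.

Lemma carleson_tail_integral n (Y : T -> R) :
  G_measurable (F n) (EFin \o Y) -> (forall x, 0 <= Y x) ->
  (\int[mu]_x ((Y x)%:E * \sum_(n <= k <oo) (alpha k x)%:E) <=
   C%:E * \int[mu]_x (Y x)%:E)%E.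
Proof.
move=> GY Y0; have [g [gE g0 gC]] := al_carleson n.
have sF := filtration_sigma filF n; have mF := @filtration_measurable _ _ F filF n.
have Y0E x : (0 <= (EFin \o Y) x)%E by rewrite lee_fin.
have mY := G_measurableW mF GY.
have mg := G_measurableW mF gE.1.
rewrite -(condexp_pullout sF mF _ _ g0 gE GY Y0E); last 2 first.
- exact: measurable_nneseries_from.
- by move=> x; exact: nneseries_ge0.
rewrite -(ge0_integralZl mu measurableT mY)//; apply: ae_ge0_le_integral => //.
- by move=> x _; rewrite mule_ge0.
- exact: emeasurable_funM.
- by move=> x _; rewrite mule_ge0.
- exact: measurable_funeM.
- by apply: filterS gC => x gxC _; rewrite muleC lee_wpmul2r.
Qed.

Section embedding.
Variables (p : R) (u : nat -> T -> R).
Hypotheses (p0 : 0 < p) (u_adapted : nneg_adapted F u).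

Let max_pow n x := running_max 0 u n x `^ p.
Let incr i x := max_pow i.+1 x - max_pow i x.

Let max_pow0 x : max_pow 0 x = 0.
Proof. by rewrite /max_pow running_max0 powR0// gt_eqF. Qed.

Let incr_ge0 i x : 0 <= incr i x.
Proof.
by rewrite subr_ge0 ler_powR2r ?(ltW p0) ?running_max_ge// running_max_homo.
Qed.

Let sum_incr n x : \sum_(i < n) incr i x = max_pow n x.
Proof.
by rewrite -(big_mkord predT (incr ^~ x)) telescope_sumr// max_pow0 subr0.
Qed.

Let G_incr i : G_measurable (F i) (EFin \o incr i).
Proof.
apply/(G_measurable_EFinP (filtration_sigma filF i)); apply: measurable_funB;
  apply: measurable_fun_powR; apply/(G_measurable_EFinP (filtration_sigma filF i));
  exact: adapted_running_max.
Qed.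

Let m_incr i : measurable_fun setT (fun x => (incr i x)%:E).
Proof. by apply: (G_measurableW (@filtration_measurable _ _ F filF i)). Qed.

Let carleson_partial_sum_le n x : (\sum_(k < n) (alpha k x * u k x `^ p)%:E <=
  \sum_(i < n) (incr i x)%:E * \sum_(i <= k <oo) (alpha k x)%:E)%E.
Proof.
apply: (@le_trans _ _ (\sum_(k < n) alpha k x * max_pow k.+1 x)%:E).
  rewrite sumEFin lee_fin; apply: ler_sum => k _.
  rewrite ler_wpM2l ?ler_powR2r ?(ltW p0)//; first by case: al_adapted.
    by case: u_adapted.
  exact: le_running_max.
rewrite (@sum_mul_increments _ (alpha ^~ x) (max_pow ^~ x))// -sumEFin.
apply: lee_sum => i _.
rewrite EFinM lee_wpmul2l ?lee_fin//; first exact: incr_ge0.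
by rewrite -sumEFin; exact: nneseries_lim_ge.
Qed.

Let term_ge0 k x : (0 <= (alpha k x * u k x `^ p)%:E)%E.
Proof. by rewrite EFinM mule_ge0// lee_fin powR_ge0. Qed.

Let mterm k : measurable_fun setT (fun x => (alpha k x * u k x `^ p)%:E).
Proof.
apply/measurable_EFinP/measurable_funM; first exact/measurable_EFinP.
by apply: measurable_fun_powR; exact: (nneg_adapted_measurable filF).
Qed.

Let carleson_partial_sum_integral n :
  (\int[mu]_x (\sum_(k < n) (alpha k x * u k x `^ p)%:E) <=
   C%:E * \int[mu]_x (max_pow n x)%:E)%E.
Proof.
have m_tail i : measurable_fun setT (fun x => \sum_(i <= k <oo) (alpha k x)%:E)%E.
  exact: measurable_nneseries_from.
have prod_ge0 i x : (0 <= (incr i x)%:E * \sum_(i <= k <oo) (alpha k x)%:E)%E.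
  by rewrite mule_ge0 ?lee_fin// nneseries_ge0.
have m_prod i : measurable_fun setT
    (fun x => (incr i x)%:E * \sum_(i <= k <oo) (alpha k x)%:E)%E.
  exact: emeasurable_funM.
apply: (@le_trans _ _
    (\int[mu]_x \sum_(i < n) (incr i x)%:E * \sum_(i <= k <oo) (alpha k x)%:E)%E).
  apply: ge0_le_integral => //.
  - by move=> x _; apply: sume_ge0.
  - by apply: emeasurable_sum => k.
  - by apply: emeasurable_sum => i.
rewrite ge0_integral_sum//.
apply: (@le_trans _ _ (\sum_(i < n) C%:E * \int[mu]_x (incr i x)%:E)%E).
  by apply: lee_sum => i _; exact: carleson_tail_integral.
rewrite -ge0_sume_distrr; last first.
  by move=> i _; apply: integral_ge0 => x _; rewrite lee_fin.
rewrite -ge0_integral_sum//; last by move=> i x _; rewrite lee_fin.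
by under eq_integral do rewrite sumEFin sum_incr.
Qed.

Lemma carleson_embedding :
  (\int[mu]_x (\sum_(k <oo) (alpha k x * u k x `^ p)%:E) <=
   C%:E * \int[mu]_x (maxfun u x `^ p))%E.
Proof.
rewrite integral_nneseries//; apply: lime_le.
  by apply: is_cvg_nneseries => n _ _; exact: integral_ge0.
apply: nearW => n; rewrite big_mkord -ge0_integral_sum//.
apply: le_trans (carleson_partial_sum_integral n) _.
apply: lee_wpmul2l; first by rewrite lee_fin.
apply: ge0_le_integral => //.
- by move=> x _; rewrite lee_fin powR_ge0.
- apply/measurable_EFinP/measurable_fun_powR.
  exact: (adapted_running_max_measurable filF).
- apply/measurable_fun_poweR/measurable_maxfun => k.
  exact: (nneg_adapted_measurable filF).
- move=> x _; rewrite /max_pow -poweR_EFin.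
  apply: lee_poweR2r; rewrite ?(ltW p0) ?lee_fin ?running_max_ge//.
  exact: running_max_le_maxfun.
Qed.

End embedding.

End carleson_embedding.

Section carleson_projection.
Context d (T : measurableType d) (R : realType).
Variables (mu : probability T R) (F : nat -> set (set T)).
Hypothesis filF : filtration F.
Variables (C : R) (e : nat -> T -> R).
Hypothesis me : forall k, measurable_fun setT (e k).
Hypothesis e0 : forall k x, 0 <= e k x.
Hypothesis sum_e : forall x, (\sum_(k <oo) (e k x)%:E <= C%:E)%E.

Let e0E k x : (0 <= (e k x)%:E)%E. Proof. by rewrite lee_fin. Qed.
Let meE k : measurable_fun setT (fun x => (e k x)%:E).
Proof. exact/measurable_EFinP. Qed.

Let tail_e_le n x : (\sum_(n <= k <oo) (e k x)%:E <= C%:E)%E.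
Proof.
apply: le_trans (sum_e x); rewrite [leRHS](nneseries_split 0 n)// add0n.
by rewrite leeDr// sume_ge0.
Qed.

Let C0 : 0 <= C.
Proof. by rewrite -lee_fin (le_trans _ (sum_e point))// nneseries_ge0. Qed.

Let e_integrable k : mu.-integrable setT (EFin \o e k).
Proof.
apply: ge0_integrable => //; apply: (@le_lt_trans _ _ (\int[mu]_x (cst C%:E x))%E).
  apply: ge0_le_integral => // x _; apply: le_trans (tail_e_le k x).
  by apply: le_trans (nneseries_lim_ge k.+1 _); rewrite ?big_nat1.
by rewrite integral_cst_prob ltry.
Qed.

Section projection.
Variable alpha : nat -> T -> R.
Hypothesis al0 : forall k x, 0 <= alpha k x.
Hypothesis alE : forall k, is_condexp mu (F k) (EFin \o e k) (EFin \o alpha k).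

Let al0E k x : (0 <= (alpha k x)%:E)%E. Proof. by rewrite lee_fin. Qed.
Let malE k : measurable_fun setT (fun x => (alpha k x)%:E).
Proof.
by apply: (G_measurableW (@filtration_measurable _ _ F filF k)); case: (alE k).
Qed.

Lemma projection_adapted : nneg_adapted F alpha.
Proof. by split=> // k; case: (alE k). Qed.

Lemma projection_tail_integral n A : F n A ->
  (\int[mu]_(x in A) (\sum_(n <= k <oo) (alpha k x)%:E) =
   \int[mu]_(x in A) (\sum_(n <= k <oo) (e k x)%:E))%E.
Proof.
move=> FA; have mA := filtration_measurable filF FA.
rewrite ge0_integral_nneseries_from// [RHS]ge0_integral_nneseries_from//.
congr (limn _); apply/funext => m; apply: eq_big_nat => k /andP[nk _].
by have [_ ->//] := alE k; exact: (filtration_le filF nk).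
Qed.

Lemma projection_carleson : carleson mu F C alpha.
Proof.
apply/(carlesonP mu filF C0 projection_adapted) => n A FA.
have mA := filtration_measurable filF FA.
rewrite projection_tail_integral// -integral_cst_fine//; apply: ge0_le_integral => //.
- by move=> x _; exact: nneseries_ge0.
- by apply: measurable_funTS; exact: measurable_nneseries_from.
Qed.

Lemma projection_sum_integral (u : nat -> T -> R) : nneg_adapted F u ->
  (\int[mu]_x (\sum_(k <oo) (alpha k x * u k x)%:E) =
   \int[mu]_x (\sum_(k <oo) (e k x * u k x)%:E))%E.
Proof.
move=> u_adapted; have [u0 Gu] := u_adapted.
have mu_ k := nneg_adapted_measurable filF k u_adapted.
have mterm (v : nat -> T -> R) k : (forall k, measurable_fun setT (v k)) ->
    measurable_fun setT (fun x => (v k x * u k x)%:E).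
  by move=> mv; apply/measurable_EFinP; exact: measurable_funM.
have mal k : measurable_fun setT (alpha k) by apply/measurable_EFinP; exact: malE.
rewrite !integral_nneseries//; do ?[by move=> k; exact: mterm|
  by move=> k x _; rewrite lee_fin mulr_ge0].
apply: eq_eseriesr => k _; under eq_integral do rewrite mulrC EFinM.
under [RHS]eq_integral do rewrite mulrC EFinM.
apply: (condexp_pullout (filtration_sigma filF k) _ (meE k) (e0E k) (al0E k)).
- exact: (filtration_measurable filF).
- exact: alE.
- exact: Gu.
- by move=> x; rewrite lee_fin.
Qed.

End projection.

Lemma carleson_projection : exists alpha : nat -> T -> R,
  [/\ nneg_adapted F alpha, carleson mu F C alpha,
      (\int[mu]_x (\sum_(k <oo) (alpha k x)%:E) =
       \int[mu]_x (\sum_(k <oo) (e k x)%:E))%E &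
      forall u : nat -> T -> R, nneg_adapted F u ->
        (\int[mu]_x (\sum_(k <oo) (alpha k x * u k x)%:E) =
         \int[mu]_x (\sum_(k <oo) (e k x * u k x)%:E))%E].
Proof.
have /choice[alpha alP] k := condexp_exists (filtration_sigma filF k)
  (@filtration_measurable _ _ F filF k) (e_integrable k) (e0E k).
have al0 k x : 0 <= alpha k x by have [_ _] := alP k.
have alE k : is_condexp mu (F k) (EFin \o e k) (EFin \o alpha k) by have [] := alP k.
exists alpha; split; [exact: projection_adapted|exact: projection_carleson| |].
- exact: projection_tail_integral (G_setT (filtration_sigma filF 0)).
- exact: projection_sum_integral.
Qed.

End carleson_projection.

Lemma nneseries_telescope (R : realType) (b : nat -> R) N :
  {homo b : m n / (m <= n)%N >-> n <= m} -> b N = 0 -> (forall k, 0 <= b k) ->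
  (\sum_(k <oo) (b k - b k.+1)%:E = (b 0%N)%:E)%E.
Proof.
move=> b_anti bN b0; have b_tail k : (N <= k)%N -> b k = 0.
  by move=> /b_anti b_le; apply/eqP; rewrite eq_le b0 andbT -bN.
rewrite (nneseries_split 0 N) ?add0n; last by move=> k _; rewrite lee_fin subr_ge0 b_anti.
rewrite [X in (_ + X)%E]eseries0 ?adde0 => [|k Nk _]; last first.
  by rewrite !b_tail ?subrr// leqW.
rewrite sumEFin (eq_bigr (fun k => - b k.+1 - - b k)) => [|k _].
  by rewrite (telescope_sumr (fun k => - b k))// opprK bN oppr0 add0r.
by rewrite opprK addrC.
Qed.

Lemma exists_argmax_partition d (T : measurableType d) (R : realType)
    (u : nat -> T -> R) N :
  (forall k, measurable_fun setT (u k)) -> (forall k x, 0 <= u k x) ->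
  exists e : nat -> T -> R,
  [/\ (forall k, measurable_fun setT (e k)), (forall k x, 0 <= e k x),
      (forall x, (\sum_(k <oo) (e k x)%:E = 1)%E) &
      (forall k x, e k x != 0 -> u k x = running_max 0 u N.+1 x)].
Proof.
move=> mu u0; pose M k := running_max (-1) u k.
have mM k : measurable_fun setT (M k) by exact: measurable_running_max.
have M_homo x : {homo M ^~ x : m n / (m <= n)%N >-> m <= n}.
  exact: running_max_homo.
have max_ge0 x : 0 <= running_max 0 u N.+1 x by exact: running_max_ge.
have M_max x : M N.+1 x = running_max 0 u N.+1 x.
  apply/eqP; rewrite eq_le; apply/andP; split; apply/bigmax_leP; split=> [|i _].
  - exact: le_trans (lerN10 R) (max_ge0 x).
  - exact: le_running_max.
  - exact: le_trans (u0 0%N x) (le_running_max _ _ _ _).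
  - exact: le_running_max.
pose before k := [set x | M k x < M N.+1 x].
have m_before k : measurable (before k).
  have := measurable_lte measurableT (f := EFin \o M k) (g := EFin \o M N.+1).
  by rewrite setTI; apply; exact/measurable_EFinP.
have before_indic k x : \1_(before k) x = (M k x < M N.+1 x)%R%:R :> R.
  by rewrite indicE; congr (_%:R); congr nat_of_bool; apply/idP/idP => [/set_mem|/mem_set].
(* The indicator of the event that the maximum is first attained at time [k];
   starting from [-1] makes time [0] no exception. *)
pose e k x : R := \1_(before k) x - \1_(before k.+1) x.
have eE k x : e k x = ((M k x < M N.+1 x) && (M N.+1 x <= M k.+1 x))%R%:R.
  rewrite /e !before_indic; have [lt|ge] := ltP (M k.+1 x) (M N.+1 x).
    by rewrite (le_lt_trans (M_homo x _ _ (leqnSn k)) lt) subrr.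
  by rewrite andbT subr0.
exists e; split=> [k|k x|x|k x].
- by apply: measurable_funB; apply: measurable_indic; exact: m_before.
- by rewrite eE.
- rewrite (@nneseries_telescope _ (fun k => \1_(before k) x) N.+1).
  + by rewrite before_indic M_max /M running_max0 (lt_le_trans _ (max_ge0 x)) ?ltrN10.
  + move=> m n mn; rewrite !before_indic ler_nat.
    by case: (ltP (M n x)) => // /(le_lt_trans (M_homo x _ _ mn)) ->.
  + by rewrite before_indic ltxx.
  + by move=> k; rewrite before_indic.
- rewrite eE; have [/andP[lt]|_] := boolP (_ && _); last by rewrite eqxx.
  rewrite {2}/M running_maxS le_max [X in X || _]leNgt lt/= => le_u _.
  apply/eqP; rewrite -M_max eq_le le_u andbT; apply: le_running_max.
  by rewrite ltnNge; apply/negP => /(M_homo x); rewrite leNgt lt.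
Qed.

Section Btilde_Bmart.
Context d (T : measurableType d) (R : realType).
Variables (mu : probability T R) (F : nat -> set (set T)).
Hypothesis filF : filtration F.
Variables (p Fv fv : R).
Hypothesis p0 : 0 < p.

Lemma Bmart_le_Btilde (M C : R) : 0 <= C ->
  (Bmart mu F p Fv fv M C <= C%:E * Btilde mu F p Fv fv)%E.
Proof.
move=> C0; apply: ge_ereal_sup.
move=> _ [f [fn [alpha [[mf f0 fF fE fnE] al_adapted al_carleson _ ->]]]].
have abs_adapted := cond_exps_adapted (cond_exps_abs filF f0 fnE) (fun n x => normr_ge0 _).
have mfn k : measurable_fun setT (fn k).
  by have [_ /measurable_int/measurable_EFinP] := fnE k.
have mal k := nneg_adapted_measurable filF k al_adapted.
have mterm (u : nat -> T -> R) k : measurable_fun setT (u k) ->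
    measurable_fun setT (fun x => (alpha k x * u k x `^ p)%:E).
  move=> mu_; apply/measurable_EFinP/measurable_funM => //.
  exact: measurable_fun_powR.
have term_ge0 (u : nat -> T -> R) k x : (0 <= (alpha k x * u k x `^ p)%:E)%E.
  by rewrite lee_fin mulr_ge0 ?powR_ge0//; case: al_adapted.
have sumE (u : nat -> T -> R) : (forall k, measurable_fun setT (u k)) ->
    (\int[mu]_x (\sum_(k <oo) (alpha k x * u k x `^ p)%:E) =
     \sum_(k <oo) \int[mu]_x (alpha k x * u k x `^ p)%:E)%E.
  move=> mu_; apply: integral_nneseries => //.
  by move=> k; exact: mterm.
have -> : (\int[mu]_x (\sum_(k <oo) (alpha k x * fn k x `^ p)%:E) =
    \int[mu]_x (\sum_(k <oo) (alpha k x * `|fn k x| `^ p)%:E))%E.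
  rewrite (sumE fn)// (sumE (fun k x => `|fn k x|)) => [|k]; last exact: measurableT_comp.
  apply: eq_eseriesr => k _; apply: ge0_ae_eq_integral => //.
  - exact: mterm.
  - by apply: (mterm (fun k x => `|fn k x|)); exact: measurableT_comp.
  - by move=> x _; exact: (term_ge0 (fun k x => `|fn k x|)).
  - by apply: filterS (cond_exps_ge0 filF f0 k fnE) => x fx0 _; rewrite ger0_norm.
apply: le_trans (carleson_embedding filF C0 al_adapted al_carleson p0 abs_adapted) _.
apply: lee_wpmul2l; first by rewrite lee_fin.
by rewrite maxfun_abs; apply: ereal_sup_ubound; exists f, fn.
Qed.

Lemma Btilde_le_Bmart : (Btilde mu F p Fv fv <= Bmart mu F p Fv fv 1 1)%E.
Proof.
apply: ge_ereal_sup => _ [f [fn [[mf f0 fF fE] fnE ->]]].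
have absE := cond_exps_abs filF f0 fnE; rewrite -maxfun_abs.
set u := fun n x => _ in absE *.
have u0 n x : 0 <= u n x by exact: normr_ge0.
have u_adapted := cond_exps_adapted absE u0.
have mu_ k := nneg_adapted_measurable filF k u_adapted.
apply: (@integral_maxfun_le _ _ _ mu u (fun N => running_max 0 u N.+1)) => //.
- by move=> N; exact: measurable_running_max.
- by move=> N x; exact: running_max_ge.
- by move=> x m n mn; exact: running_max_homo.
- by move=> N x; exists N; rewrite ger0_norm// le_running_max.
move=> N; have [e [me e0 sum_e e_max]] := exists_argmax_partition N mu_ u0.
have sum_e_le x : (\sum_(k <oo) (e k x)%:E <= 1%:E)%E by rewrite sum_e.
have [alpha [al_adapted al_carleson al_sum al_term]] :=
  carleson_projection mu filF me e0 sum_e_le.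
apply: ereal_sup_ubound; exists f, u, alpha; split=> //.
  by rewrite al_sum; under eq_integral do rewrite sum_e; rewrite [LHS]integral_cst_prob.
rewrite (al_term _ (nneg_adapted_powR filF p u_adapted)).
apply: eq_integral => x _.
transitivity (\sum_(k <oo) ((running_max 0 u N.+1 x `^ p)%:E * (e k x)%:E))%E.
  by rewrite nneseriesZl ?sum_e ?mule1// => k _; rewrite lee_fin.
apply: eq_eseriesr => k _; rewrite -EFinM mulrC; congr EFin.
by have [->|/e_max ->//] := eqVneq (e k x) 0; rewrite !mul0r.
Qed.

Lemma Btilde_eq_Bmart : Btilde mu F p Fv fv = Bmart mu F p Fv fv 1 1.
Proof.
apply/eqP; rewrite eq_le Btilde_le_Bmart/=.
by rewrite -[leRHS]mul1e Bmart_le_Btilde.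
Qed.

End Btilde_Bmart.

(** * The upper bound *)

Lemma powR_doob (R : realType) (p x y : R) : 1 < p -> 0 <= x -> 0 <= y ->
  (p - 1) * (y `^ p - x `^ p) <= p * (y * (y `^ (p - 1) - x `^ (p - 1))).
Proof.
move=> p1 x0 y0; have := powR_young p1 x0 y0.
have <- : y * y `^ (p - 1) = y `^ p by rewrite mulr_powRB1//; lra.
by lra.
Qed.

Section doob_inequality.
Context d (T : measurableType d) (R : realType).
Variables (mu : probability T R) (F : nat -> set (set T)).
Hypothesis filF : filtration F.
Variables (f : T -> R) (fn : nat -> T -> R).
Hypotheses (mf : measurable_fun setT f) (f0 : forall x, 0 <= f x).
Hypotheses (fnE : cond_exps mu F f fn) (fn0 : forall n x, 0 <= fn n x).
Variables (p c : R) (m : nat -> T -> R).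
Hypotheses (p1 : 1 < p) (c0 : 0 <= c) (m0 : forall x, m 0%N x = c).
Hypothesis m_leS : forall n x, m n x <= m n.+1 x.
Hypothesis Gm : forall n, G_measurable (F n) (EFin \o m n.+1).
Hypothesis m_jump : forall n x, m n x < m n.+1 x -> m n.+1 x <= fn n x.

Let p0 : 0 < p. Proof. exact: lt_trans p1. Qed.
Let p10 : 0 <= p - 1. Proof. by rewrite subr_ge0 ltW. Qed.

Let m_ge n x : c <= m n x.
Proof. by elim: n => [|n /le_trans->//]; rewrite m0. Qed.

Let m_ge0 n x : 0 <= m n x. Proof. exact: le_trans (m_ge n x). Qed.

Let Gm_prev n : G_measurable (F n) (EFin \o m n).
Proof.
case: n => [|n]; last first.
  by move=> B mB; apply: (filtration_le filF (leqnSn n)); exact: Gm.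
rewrite (_ : m 0%N = cst c); last exact/funext.
by apply/(G_measurable_EFinP (filtration_sigma filF 0)); exact: measurable_cst.
Qed.

Let mm n : measurable_fun setT (m n).
Proof. by apply: (G_measurable_EFinW (@filtration_measurable _ _ F filF n)); exact: Gm_prev. Qed.

Let incr i x := m i.+1 x `^ (p - 1) - m i x `^ (p - 1).

Let incr_ge0 i x : 0 <= incr i x. Proof. by rewrite subr_ge0 ler_powR2r. Qed.

Let sum_incr n x : \sum_(i < n) incr i x = m n x `^ (p - 1) - c `^ (p - 1).
Proof.
by rewrite -(big_mkord predT (incr ^~ x)) (telescope_sumr (fun i => m i x `^ (p - 1)))// m0.
Qed.

Let G_incr i : G_measurable (F i) (EFin \o incr i).
Proof.
apply/(G_measurable_EFinP (filtration_sigma filF i)); apply: measurable_funB;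
  apply: measurable_fun_powR; apply/(G_measurable_EFinP (filtration_sigma filF i));
  [exact: Gm|exact: Gm_prev].
Qed.

Let m_incr i : measurable_fun setT (incr i).
Proof. by apply: (G_measurable_EFinW (@filtration_measurable _ _ F filF i)); exact: G_incr. Qed.

Let mfn i : measurable_fun setT (fn i).
Proof. by have [_ /measurable_int/measurable_EFinP] := fnE i. Qed.

Let pow_le_sum_incr n x :
  (p - 1) * m n x `^ p <= (p - 1) * c `^ p + p * \sum_(i < n) incr i x * fn i x.
Proof.
elim: n => [|n IHn]; first by rewrite big_ord0 mulr0 addr0 m0.
rewrite big_ord_recr /=.
have incr_fn : m n.+1 x * incr n x <= fn n x * incr n x.
  have [/m_jump/ler_wpM2r->//|ge] := ltP (m n x) (m n.+1 x).
  have mE : m n.+1 x = m n x by apply/eqP; rewrite eq_le ge m_leS.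
  by rewrite /incr mE subrr !mulr0.
have := powR_doob p1 (m_ge0 n x) (m_ge0 n.+1 x); rewrite -/(incr n x) => doob.
by rewrite -(ler_pM2l p0) in incr_fn; lra.
Qed.

Let integral_sum_incr n : (\int[mu]_x (\sum_(i < n) incr i x * fn i x)%:E =
  \int[mu]_x (f x * (m n x `^ (p - 1) - c `^ (p - 1)))%:E)%E.
Proof.
have mfE : measurable_fun setT (EFin \o f) by exact/measurable_EFinP.
have m_prod (u : nat -> T -> R) i : (forall k, measurable_fun setT (u k)) ->
    measurable_fun setT (fun x => (incr i x * u i x)%:E).
  by move=> mu_; apply/measurable_EFinP; exact: measurable_funM.
have integral_term i : (\int[mu]_x (incr i x * fn i x)%:E = \int[mu]_x (incr i x * f x)%:E)%E.
  under eq_integral do rewrite EFinM.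
  under [RHS]eq_integral do rewrite EFinM.
  apply: (condexp_pullout (filtration_sigma filF i) (@filtration_measurable _ _ F filF i)
    mfE _ _ _ (G_incr i)) => [x|x||x]; rewrite ?lee_fin//.
  by have [] := fnE i.
under eq_integral do rewrite -sumEFin.
rewrite ge0_integral_sum//; last 2 first.
- by move=> i; exact: m_prod.
- by move=> i x _; rewrite lee_fin mulr_ge0.
under eq_bigr do rewrite integral_term.
rewrite -ge0_integral_sum//; last 2 first.
- by move=> i; exact: (m_prod (fun=> f)).
- by move=> i x _; rewrite lee_fin mulr_ge0.
by apply: eq_integral => x _; rewrite sumEFin -mulr_suml sum_incr mulrC.
Qed.

Lemma doob_inequality n :
  ((p - 1)%:E * \int[mu]_x (m n x `^ p)%:E +
     (p * c `^ (p - 1))%:E * \int[mu]_x (f x)%:E <=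
   ((p - 1) * c `^ p)%:E + p%:E * \int[mu]_x (f x * m n x `^ (p - 1))%:E)%E.
Proof.
have mmp q : measurable_fun setT (fun x => m n x `^ q) by exact: measurable_fun_powR.
have cpow_ge0 q : 0 <= c `^ q by exact: powR_ge0.
pose S x := \sum_(i < n) incr i x * fn i x.
have mS : measurable_fun setT S.
  by apply: measurable_sum => i; exact: measurable_funM.
have S0 x : 0 <= S x by apply: sumr_ge0 => i _; rewrite mulr_ge0.
have mfd : measurable_fun setT (fun x => f x * (m n x `^ (p - 1) - c `^ (p - 1))).
  by apply: measurable_funM => //; exact: measurable_funB.
have fd0 x : 0 <= f x * (m n x `^ (p - 1) - c `^ (p - 1)).
  by rewrite mulr_ge0// subr_ge0 ler_powR2r.
have integral_le : ((p - 1)%:E * \int[mu]_x (m n x `^ p)%:E <=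
    ((p - 1) * c `^ p)%:E + p%:E * \int[mu]_x (S x)%:E)%E.
  have <- : (\int[mu]_x ((p - 1) * c `^ p * cst 1 x + p * S x)%:E =
      ((p - 1) * c `^ p)%:E + p%:E * \int[mu]_x (S x)%:E)%E.
    rewrite ge0_integral_lincomb ?mulr_ge0 ?(ltW p0)//.
    by rewrite -[X in (_ * X + _)%E]/(\int[mu]_x cst 1%E x)%E integral_cst_prob mule1.
  rewrite -ge0_integralZl ?lee_fin//; last 2 first.
  - exact/measurable_EFinP.
  - by move=> x _; rewrite lee_fin powR_ge0.
  apply: ge0_le_integral_EFin => //.
  - exact: measurable_funM.
  - by apply: measurable_funD; exact: measurable_funM.
  - by move=> x; rewrite mulr_ge0 ?powR_ge0//= mulr1 pow_le_sum_incr.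
apply: le_trans (leeD integral_le (lexx _)) _.
rewrite integral_sum_incr -addeA leeD2l// -ge0_integral_lincomb ?mulr_ge0 ?(ltW p0)//.
rewrite -ge0_integralZl ?lee_fin ?(ltW p0)//; last 2 first.
- by apply/measurable_EFinP; exact: measurable_funM.
- by move=> x _; rewrite lee_fin mulr_ge0 ?powR_ge0.
by rewrite le_eqVlt; apply/orP; left; apply/eqP; apply: eq_integral => x _;
  rewrite -EFinM; congr EFin; ring.
Qed.

End doob_inequality.

Lemma integral_powR_young (R : realType) d (T : measurableType d)
    (mu : {measure set T -> \bar R}) (p b : R) (f m : T -> R) : 1 < p -> 0 <= b ->
  measurable_fun setT f -> measurable_fun setT m ->
  (forall x, 0 <= f x) -> (forall x, 0 <= m x) ->
  ((p * b `^ (p - 1))%:E * \int[mu]_x (f x * m x `^ (p - 1))%:E <=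
   \int[mu]_x (f x `^ p)%:E + ((p - 1) * b `^ p)%:E * \int[mu]_x (m x `^ p)%:E)%E.
Proof.
move=> p1 b0 mf mm f0 m0.
have p10 : 0 <= p - 1 by rewrite subr_ge0 ltW.
have coef0 : 0 <= p * b `^ (p - 1) by rewrite mulr_ge0 ?powR_ge0// ltW// (lt_trans _ p1).
have mmp q : measurable_fun setT (fun x => m x `^ q) by exact: measurable_fun_powR.
have mfp : measurable_fun setT (fun x => f x `^ p) by exact: measurable_fun_powR.
have mfm : measurable_fun setT (fun x => f x * m x `^ (p - 1)) by exact: measurable_funM.
rewrite -[X in (_ <= X + _)%E]mul1e -ge0_integral_lincomb ?mulr_ge0 ?powR_ge0//;
  do ?by move=> x; exact: powR_ge0.
rewrite -ge0_integralZl ?lee_fin//; last 2 first.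
- exact/measurable_EFinP.
- by move=> x _; rewrite lee_fin mulr_ge0 ?powR_ge0.
apply: ge0_le_integral_EFin => // [||x].
- exact: measurable_funM.
- by apply: measurable_funD; exact: measurable_funM.
- rewrite !mulr_ge0 ?powR_ge0 ?(le_trans _ (ltW p1))//= mul1r.
  by have := powR_young p1 (mulr_ge0 b0 (m0 x)) (f0 x); rewrite !powRM//; lra.
Qed.

Lemma maximal_bound_arith (R : realType) (p a B V I J Fv : R) :
  1 < p -> 0 < a -> a * p < 1 -> 0 < B ->
  (p - 1) * I + p * V <= (p - 1) * V + p * J ->
  p * B * J <= Fv + (p - 1) * ((1 - a) * B) * I ->
  Fv <= V * ((1 - a) * B / (1 - a * p)) -> I <= V / (1 - a * p).
Proof.
move=> p1 a0 ap B0 doob young; have ap0 : 0 < 1 - a * p by rewrite subr_gt0.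
rewrite mulrA !ler_pdivlMr// => Fv_le.
have le_Fv : (p - 1) * B * a * I <= Fv - B * V.
  have : B * ((p - 1) * I + p * V) <= B * ((p - 1) * V + p * J) by rewrite ler_pM2l.
  by lra.
have scaled_le : (p - 1) * B * a * I * (1 - a * p) <= (Fv - B * V) * (1 - a * p).
  by rewrite ler_pM2r.
have coef_gt0 : 0 < (p - 1) * B * a by rewrite !mulr_gt0// subr_gt0.
by rewrite -(ler_pM2l coef_gt0); lra.
Qed.

Section maximal_upper.
Context d (T : measurableType d) (R : realType).
Variables (mu : probability T R) (F : nat -> set (set T)).
Hypothesis filF : filtration F.
Variables (f : T -> R) (fn : nat -> T -> R) (p a Fv fv : R).
Hypotheses (f_moments : has_moments mu p Fv fv f) (fnE : cond_exps mu F f fn).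
Hypothesis fn0 : forall n x, 0 <= fn n x.
Hypotheses (p1 : 1 < p) (fv0 : 0 <= fv) (a0 : 0 < a) (ap : a * p < 1).
Hypothesis FvE : Fv <= fv `^ p * ((1 - a) `^ p / (1 - a * p)).

Let p0 : 0 < p. Proof. exact: lt_trans p1. Qed.
Let mf : measurable_fun setT f. Proof. by case: f_moments. Qed.
Let f0 x : 0 <= f x. Proof. by case: f_moments. Qed.
Let fn_adapted : nneg_adapted F fn.
Proof. exact: cond_exps_adapted fnE fn0. Qed.

Let b := 1 - a.
Let b0 : 0 < b. Proof. by rewrite subr_gt0 (lt_trans _ ap)// ltr_pMr. Qed.

Let maximum n x := running_max fv fn n x.

(* Truncation makes the integrals finite before anything is subtracted. *)
Let truncated L n x := Num.min (maximum n x) L.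

Let m_truncated L n : measurable_fun setT (truncated L n).
Proof.
apply: measurable_minr; last exact: measurable_cst.
exact: (adapted_running_max_measurable filF _ _ fn_adapted).
Qed.

Section truncation.
Variables (L : R) (fvL : fv <= L).
Local Notation m := (truncated L).

Let m_ge0 n x : 0 <= m n x.
Proof. by rewrite le_min !(le_trans fv0)// running_max_ge. Qed.

Let m0 x : m 0 x = fv.
Proof. by rewrite /truncated /maximum running_max0 min_l. Qed.

Let m_leS n x : m n x <= m n.+1 x.
Proof. by rewrite le_min !ge_min running_max_homo// lexx orbT. Qed.

Let Gm n : G_measurable (F n) (EFin \o m n.+1).
Proof.
apply/(G_measurable_EFinP (filtration_sigma filF n)).
apply: measurable_minr; last exact: measurable_cst.
apply/(G_measurable_EFinP (filtration_sigma filF n)).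
exact: (adapted_running_max filF _ fn_adapted).
Qed.

Let m_jump n x : m n x < m n.+1 x -> m n.+1 x <= fn n x.
Proof.
rewrite /truncated /maximum running_maxS.
case: (leP (running_max fv fn n x) (fn n x)) => _; last by rewrite ltxx.
by rewrite ge_min lexx.
Qed.

Lemma integral_truncated_maximum_le n :
  (\int[mu]_x (m n x `^ p)%:E <= (fv `^ p / (1 - a * p))%:E)%E.
Proof.
have [_ _ int_fp int_f] := f_moments.
have bp0 : 0 < b `^ (p - 1) by exact: powR_gt0.
have bpE : b `^ p = b * b `^ (p - 1) by rewrite mulr_powRB1// ltW.
have coef0 : 0 < p * b `^ (p - 1) by rewrite mulr_gt0.
have mmp : measurable_fun setT (fun x => m n x `^ p).
  by apply: measurable_fun_powR; exact: m_truncated.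
have [I int_mE] : exists I : R, (\int[mu]_x (m n x `^ p)%:E = I%:E)%E.
  exists (fine (\int[mu]_x (m n x `^ p)%:E)); rewrite fineK// ge0_fin_numE; last first.
    by apply: integral_ge0 => x _; rewrite lee_fin powR_ge0.
  apply: (@le_lt_trans _ _ (\int[mu]_x (cst (L `^ p)%:E x))%E).
    apply: ge0_le_integral_EFin => // x; rewrite powR_ge0/=.
    by rewrite ler_powR2r ?(ltW p0)// ge_min lexx orbT.
  by rewrite integral_cst_prob ltry.
have := integral_powR_young mu p1 (ltW b0) mf (m_truncated L n) f0 (m_ge0 n).
rewrite int_fp int_mE -EFinM -EFinD => young.
have [J int_fmE] : exists J : R, (\int[mu]_x (f x * m n x `^ (p - 1))%:E = J%:E)%E.
  exists (fine (\int[mu]_x (f x * m n x `^ (p - 1))%:E)); rewrite fineK// ge0_fin_numE.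
    rewrite ltey; apply/eqP => int_oo; move: young.
    by rewrite int_oo gt0_muley ?lte_fin.
  by apply: integral_ge0 => x _; rewrite lee_fin mulr_ge0 ?powR_ge0.
have := doob_inequality filF mf f0 fnE fn0 p1 fv0 m0 m_leS Gm m_jump n.
rewrite int_mE int_f int_fmE -!EFinM -!EFinD !lee_fin => doob.
apply: (maximal_bound_arith p1 a0 ap bp0 _ _ (J := J) (Fv := Fv)).
- by move: doob; rewrite -mulrA (mulrC _ fv) mulr_powRB1.
- by move: young; rewrite int_fmE -EFinM lee_fin bpE.
- by rewrite -/b -bpE.
Qed.

End truncation.

Lemma integral_maxfun_upper :
  (\int[mu]_x (maxfun fn x `^ p) <= (fv `^ p / (1 - a * p))%:E)%E.
Proof.
apply: (@integral_maxfun_le _ _ _ mu fn (fun n => truncated (fv + n%:R) n)) => //.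
- by move=> n; have [_ /measurable_int/measurable_EFinP] := fnE n.
- by move=> n x; rewrite le_min (le_trans fv0) ?running_max_ge ?addr_ge0.
- move=> x i j ij; rewrite le_min !ge_min lerD2l ler_nat ij orbT andbT.
  by rewrite running_max_homo.
- move=> n x; pose k := Num.bound (fn n x); exists (maxn n.+1 k).
  rewrite ger0_norm// le_min le_running_max ?leq_maxl//=.
  rewrite (le_trans (ltW (archi_boundP (fn0 n x))))//.
  by rewrite ler_wpDl// ler_nat leq_maxr.
- by move=> n; apply: integral_truncated_maximum_le; rewrite lerDl.
Qed.

End maximal_upper.

Lemma Btilde_upper (R : realType) d (T : measurableType d) (mu : probability T R)
    (F : nat -> set (set T)) (p a fv Fv : R) :
  filtration F -> 1 < p -> 0 < a -> a * p < 1 -> 0 <= fv ->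
  Fv <= fv `^ p * ((1 - a) `^ p / (1 - a * p)) ->
  (Btilde mu F p Fv fv <= (fv `^ p / (1 - a * p))%:E)%E.
Proof.
move=> filF p1 a0 ap fv0 FvE; apply: ge_ereal_sup.
move=> _ [f [fn [f_moments fnE ->]]]; have [_ f0 _ _] := f_moments.
rewrite -maxfun_abs; have absE := cond_exps_abs filF f0 fnE.
exact: (integral_maxfun_upper filF f_moments absE (fun _ _ => normr_ge0 _) p1 fv0 a0 ap FvE).
Qed.

(** * Splitting sets along an infinitely refining filtration *)

Section uniform_shares.
Context d (T : measurableType d) (R : realType).
Variables (mu : probability T R) (F : nat -> set (set T)).
Local Notation pr A := (fine (mu A)).
Implicit Types (A E W : set T) (G : set (set T)).

Definition uniform_share G (s eta : R) E W : Prop :=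
  forall A, G A -> `|pr (W `&` A) - s * pr (E `&` A)| <= eta.

Definition uniform_chain (s e : R) (E : nat -> set T) (k : nat -> nat) : Prop :=
  E 0%N = setT /\ forall j, [/\ F (k j) (E j), E j.+1 `<=` E j, 0 < pr (E j) &
    uniform_share (F (k j)) s (e * pr (E j)) (E j) (E j `\` E j.+1)].

Hypothesis filF : filtration F.
Let sF n : sigma_algebra setT (F n). Proof. exact: filtration_sigma. Qed.
Let mF n A : F n A -> measurable A. Proof. exact: filtration_measurable. Qed.

Lemma integral_sign (h : T -> R) E A : measurable E -> measurable A -> A `<=` E ->
  mu.-integrable setT (EFin \o h) -> (forall x, `|h x * \1_E x| = \1_E x) ->
  measurable [set x | h x = 1] ->
  (\int[mu]_(x in A) (h x)%:E = (2 * pr ([set x | h x = 1] `&` A) - pr A)%:E)%E.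
Proof.
move=> mE mA AE ih habs m1; set W := [set x | h x = 1] in m1 *.
have ihA : mu.-integrable A (EFin \o h) by exact: integrableS ih.
have : (\int[mu]_(x in A) ((h x)%:E + cst 1%E x) =
    \int[mu]_(x in A) (2%:E * (\1_W x)%:E))%E.
  apply: eq_integral => x /[!inE] Ax; rewrite -EFinM -EFinD; congr EFin.
  have := habs x; rewrite !indicE mem_set ?mulr1; last exact: AE.
  have [xW _|xW] := boolP (x \in W); first by rewrite (set_mem xW : h x = 1) mulr1.
  move=> /eqP; rewrite eqr_norml ler01 andbT mulr0 => /orP[/eqP h1|/eqP->].
    by move/negP: xW; case; exact: mem_set.
  by rewrite addNr.
rewrite integralD//; last exact: finite_measure_integrable_cst.
rewrite (integral_cst_fine mu 1) ?mul1r// ge0_integralZl//; last first.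
  by apply/measurable_EFinP; exact: measurable_indic.
by rewrite integral_indic_fine// -EFinM EFinB => <-; rewrite addeK.
Qed.

Lemma halving_inf_refining :
  (forall n, exists2 W, F n.+1 W & forall A, F n A -> pr (W `&` A) = 2^-1 * pr A) ->
  inf_refining mu F.
Proof.
move=> half eps n E eps0 FE; have [W FW halfW] := half n.
have mW := mF FW; pose h x : R := if x \in W then 1 else -1.
have absh x : `|h x| = 1 by rewrite /h; case: ifP; rewrite ?normrN1 ?normr1.
have hW : [set x | h x = 1] = W.
  apply/seteqP; split=> x; rewrite /h /=; last by move=> Wx; rewrite mem_set.
  by case: ifPn => [/set_mem//|_ N1E1]; exfalso; move: N1E1; lra.
have Gh : G_measurable (F n.+1) (EFin \o h).
  apply/(G_measurable_EFinP (sF n.+1)); apply: measurable_fun_ifT => //.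
  apply: (measurable_fun_bool true); rewrite setTI preimage_mem_true.
  by rewrite measurable_subsigmaE.
have ih : mu.-integrable setT (EFin \o h).
  apply/integrableP; split; first exact: (G_measurableW (@mF n.+1)).
  by under eq_integral do rewrite /= absh; rewrite integral_cst_prob ltry.
exists n.+1, h; split=> // [x|]; first by rewrite normrM absh mul1r ger0_norm.
exists (cst 0); split.
- split=> [|A FA].
    by apply/(G_measurable_EFinP (sF n)); exact: measurable_cst.
  rewrite [LHS]integral0 [RHS](integral_sign measurableT (mF FA))//.
  + by rewrite hW halfW// mulrA mulfV// mul1r subrr.
  + by move=> x; rewrite normrM absh mul1r ger0_norm.
  + by rewrite hW.
- exact: finite_measure_integrable_cst.
- by under eq_integral do rewrite normr0; rewrite integral0 lee_fin ltW.
Qed.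

Hypothesis irF : inf_refining mu F.

Lemma refining_half n E (eta : R) : 0 < eta -> F n E ->
  exists k W, [/\ (n <= k)%N, F k W, W `<=` E & uniform_share (F n) 2^-1 eta E W].
Proof.
move=> eta0 FE; have [k [h [nk Gh ih habs [g [[Gg gh] ig gE]]]]] := irF eta0 FE.
pose W1 := [set x | h x = 1].
have FW1 : F k W1.
  rewrite /W1 (_ : [set x | _] = (EFin \o h) @^-1` [set 1%E]); first exact: Gh.
  by apply/seteqP; split => x /= [->].
exists k, (E `&` W1); split; [exact: ltnW| |exact: subIsetl|move=> A FA].
  by apply: (G_setI (sF k)) => //; exact: (filtration_le filF (ltnW nk)).
have FEA := G_setI (sF n) FE FA.
have := integral_sign (mF FE) (mF FEA) (@subIsetl _ _ _) ih habs (mF FW1).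
rewrite -[LHS](gh _ FEA) setICA setIA => int_g.
have : (`|(2 * pr (E `&` W1 `&` A) - pr (E `&` A))%:E| <= eta%:E)%E.
  have mg := measurable_int _ ig.
  rewrite -int_g; apply: le_trans (le_abse_integral mu (mF FEA) _) _.
    exact: measurable_funTS.
  apply: le_trans gE; apply: ge0_subset_integral => //.
  - exact: mF FEA.
  - exact: mF FE.
  - by apply: measurable_funTS; exact: measurableT_comp mg.
rewrite /= lee_fin => defect_le.
rewrite (_ : _ - _ = 2^-1 * (2 * pr (E `&` W1 `&` A) - pr (E `&` A))); last by field.
rewrite normrM gtr0_norm ?invr_gt0//; apply: le_trans defect_le.
by rewrite ler_piMl// invf_le1 ?ler1n.
Qed.

Lemma refining_expr n E (eta : R) i : 0 < eta -> F n E ->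
  exists k W, [/\ (n <= k)%N, F k W, W `<=` E &
    uniform_share (F n) (2^-1 ^+ i) eta E W].
Proof.
move=> eta0 FE; elim: i => [|i [k [W [nk FW WE shareW]]]].
  by exists n, E; split => // A _; rewrite expr0 mul1r subrr normr0 ltW.
have eta20 : 0 < eta / 2 by rewrite divr_gt0.
have [k' [W' [kk' FW' W'W shareW']]] := refining_half eta20 FW.
exists k', W'; split => //; [exact: leq_trans kk'|exact: subset_trans WE|].
move=> A FA; have := shareW _ FA.
have := shareW' A (filtration_le filF nk FA); rewrite !ler_norml exprS.
move: (pr (W' `&` A)) (pr (W `&` A)) (pr (E `&` A)) (2^-1 ^+ i) => x y z q.
by move=> /andP[? ?] /andP[? ?]; apply/andP; split; lra.
Qed.

Lemma refining_small_set (delta : R) : 0 < delta ->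
  exists2 B, measurable B & 0 < pr B <= delta.
Proof.
move=> delta0.
have half_cvg0 : (2^-1 : R) ^+ i @[i --> \oo] --> 0.
  by apply: cvg_expr; rewrite ger0_norm ?invr_ge0// invf_lt1// ltr1n.
have delta20 : 0 < delta / 2 by rewrite divr_gt0.
have /cvgrPdist_le/(_ _ delta20)[i _ /(_ i (leqnn i))] := half_cvg0.
rewrite /= sub0r normrN gtr0_norm// => le_delta.
have eta0 : 0 < (2^-1 : R) ^+ i / 2 by rewrite divr_gt0.
have [k [B [_ FB _ /(_ setT (G_setT (sF 0)))]]] := refining_expr i eta0 (G_setT (sF 0)).
rewrite !setIT fine_prob_setT ler_norml => /andP[? ?].
by exists B; [exact: mF FB|apply/andP; split; lra].
Qed.

Lemma refining_chain (e : R) i : 0 < e -> 2^-1 ^+ i + e < 1 ->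
  exists (E : nat -> set T) (k : nat -> nat), uniform_chain (2^-1 ^+ i) e E k.
Proof.
move=> e0 share_lt1.
have /choice[next nextP] : forall kE : nat * set T, exists kW : nat * set T,
    F kE.1 kE.2 -> 0 < pr kE.2 -> [/\ (kE.1 <= kW.1)%N, F kW.1 kW.2, kW.2 `<=` kE.2 &
      uniform_share (F kE.1) (2^-1 ^+ i) (e * pr kE.2) kE.2 kW.2].
  move=> [k E] /=; have [[FE E0]|nFE] := pselect (F k E /\ 0 < pr E); last first.
    by exists (k, E) => ? ?; exfalso; exact: nFE.
  have [k' [W [kk' FW WE shareW]]] := refining_expr i (mulr_gt0 e0 E0) FE.
  by exists (k', W).
pose chain := fix chain n : nat * set T := if n is n'.+1 then
  let kE := chain n' in ((next kE).1, kE.2 `\` (next kE).2) else (0%N, setT).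
have chainP j : F (chain j).1 (chain j).2 /\ 0 < pr (chain j).2.
  elim: j => [|j [FE E0]] /=; first by split; [exact: G_setT|rewrite fine_prob_setT].
  have [kk' FW WE shareW] := nextP _ FE E0; split.
    by apply: (G_setD (sF _)) => //; exact: (filtration_le filF kk').
  rewrite fine_prob_setD//; [|exact: (mF FE)|exact: (mF FW)].
  have := shareW setT (G_setT (sF _)); rewrite !setIT ler_norml => /andP[_].
  have : 0 < (1 - (2^-1 ^+ i + e)) * pr (chain j).2 by rewrite mulr_gt0// subr_gt0.
  by move: (pr (chain j).2) (pr (next _).2) (2^-1 ^+ i) => x y q; lra.
exists (fun j => (chain j).2), (fun j => (chain j).1); split => // j.
have [FE E0] := chainP j; have [kk' FW WE shareW] := nextP _ FE E0.
by split => //=; rewrite setDD setIidr.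
Qed.

End uniform_shares.

Section condexp_on_shares.
Context d (T : measurableType d) (R : realType).
Variables (mu : probability T R) (G : set (set T)).
Hypotheses (sG : sigma_algebra setT G) (Gm : G `<=` measurable).
Local Notation pr A := (fine (mu A)).
Variables (E W : set T) (s eta : R).
Hypotheses (GE : G E) (mW : measurable W) (WE : W `<=` E).
Hypothesis shareW : uniform_share mu G s eta E W.

Lemma share_density_defect (g : T -> R) : (forall x, 0 <= g x) ->
  is_condexp mu G (EFin \o \1_W) (EFin \o g) ->
  (\int[mu]_(x in E) (Num.max (s - g x) 0)%:E <= eta%:E)%E.
Proof.
move=> g0 [Gg gW]; have mg := G_measurable_EFinW Gm Gg.
pose A := [set x | g x < s].
have GA : G A.
  apply: (G_set_lt sG (X := cst s)) => //.
  by apply/(G_measurable_EFinP sG); exact: measurable_cst.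
have GEA : G (E `&` A) by exact: G_setI.
have mEA := Gm GEA.
have -> : (\int[mu]_(x in E) (Num.max (s - g x) 0)%:E =
    \int[mu]_(x in E `&` A) (s - g x)%:E)%E.
  rewrite [RHS]integral_mkcondr; apply: eq_integral => x _; rewrite patchE.
  case: ifPn => [/set_mem/ltW xA|xA]; first by rewrite max_l ?subr_ge0.
  rewrite max_r// subr_le0 leNgt; apply/negP => xs; move/negP: xA; apply.
  exact: mem_set.
have gWA : (\int[mu]_(x in E `&` A) (g x)%:E = (pr (W `&` A))%:E)%E.
  rewrite [LHS]gW// integral_indic_fine//; first by rewrite setIA (setIidl WE).
have sumE : (\int[mu]_(x in E `&` A) (s - g x)%:E + \int[mu]_(x in E `&` A) (g x)%:E =
    (s * pr (E `&` A))%:E)%E.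
  rewrite -ge0_integralD//; last 4 first.
  - by move=> x [_ /ltW xs]; rewrite lee_fin subr_ge0.
  - by apply/measurable_funTS/measurable_EFinP/measurable_funB.
  - by move=> x _; rewrite lee_fin.
  - by apply/measurable_funTS/measurable_EFinP.
  rewrite -integral_cst_fine//; apply: eq_integral => x _.
  by rewrite -EFinD subrK.
rewrite gWA in sumE; rewrite -(@leeD2rE _ (pr (W `&` A))%:E)// sumE -EFinD lee_fin.
by have := shareW GA; rewrite ler_norml => /andP[+ _]; lra.
Qed.

(* The integral of [X] over [W] is that of [g * f], with [g] the conditional
   expectation of the indicator of [W], and [g] is nearly [s] on [E]. *)
Lemma condexp_share_lower (K : R) (f X : T -> R) : 0 <= s -> 0 <= K ->
  measurable_fun setT f -> (forall x, 0 <= f x <= K) -> (forall x, 0 <= X x) ->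
  is_condexp mu G (EFin \o f) (EFin \o X) ->
  (s%:E * \int[mu]_(x in E) (f x)%:E <= \int[mu]_(x in W) (X x)%:E + (K * eta)%:E)%E.
Proof.
move=> s0 K0 mf fK X0 Xf; have mE := Gm GE.
have f0 x : 0 <= f x by have /andP[] := fK x.
have mWE : measurable_fun setT (EFin \o \1_W : T -> \bar R).
  exact/measurable_EFinP/measurable_indic.
have indic0 x : (0 <= (\1_W x : R)%:E)%E by rewrite lee_fin.
have [g [gW ig g0]] := condexp_exists sG Gm (integrable_indic mu mW) indic0.
have mg := G_measurable_EFinW Gm gW.1.
have intWX : (\int[mu]_(x in W) (X x)%:E = \int[mu]_x (g x * f x)%:E)%E.
  rewrite -(setTI W) -ge0_integral_mulr_indic//.
  under [RHS]eq_integral do rewrite EFinM.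
  apply: (condexp_adjoint sG Gm _ mWE) => //; exact/measurable_EFinP.
have mdefect : measurable_fun setT (fun x => Num.max (s - g x) 0).
  by apply: measurable_maxr => //; apply: measurable_funB.
have pointwise x : s * f x <= 1 * (g x * f x) + K * Num.max (s - g x) 0.
  have /andP[_ fK_x] := fK x; rewrite mul1r.
  have [gs|/ltW sg] := leP (s - g x) 0.
    by rewrite mulr0 addr0 ler_wpM2r// -subr_le0.
  have := ler_wpM2r sg fK_x; lra.
rewrite intWX -ge0_integralZl//; last 2 first.
- by apply/measurable_funTS/measurable_EFinP.
- by move=> x _; rewrite lee_fin.
apply: (@le_trans _ _
    (\int[mu]_(x in E) (1 * (g x * f x) + K * Num.max (s - g x) 0)%:E)%E).
  apply: ge0_le_integral_EFin => // [||x].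
  - exact/measurable_funTS/measurable_funM.
  - apply: measurable_funTS; apply: measurable_funD; first exact/measurable_funM/measurable_funM.
    exact: measurable_funM.
  - by rewrite mulr_ge0//=; exact: pointwise.
rewrite ge0_integral_lincomb//; do ?[exact: measurable_funTS|by move=> x; rewrite mulr_ge0|
  by move=> x; rewrite le_max lexx orbT]; last exact/measurable_funTS/measurable_funM.
rewrite mul1e leeD//.
  apply: ge0_subset_integral => //; first exact/measurable_EFinP/measurable_funM.
  by move=> x _; rewrite lee_fin mulr_ge0.
by rewrite EFinM lee_wpmul2l ?lee_fin// share_density_defect.
Qed.

End condexp_on_shares.

(** * Extremal functions *)

Section chain_levels.
Context d (T : measurableType d) (R : realType).
Variables (mu : probability T R) (E : nat -> set T).
Hypotheses (mE : forall j, measurable (E j)) (ES : forall j, E j.+1 `<=` E j).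
Local Notation m j := (fine (mu (E j))).

Fixpoint level (J : nat) x : nat :=
  if J is J'.+1 then (if x \in E J then J else level J' x) else 0%N.

Lemma level_last J x : E J x -> level J x = J.
Proof. by case: J => //= J xE; rewrite mem_set. Qed.

Lemma chain_sub i j : (i <= j)%N -> E j `<=` E i.
Proof.
move=> ij; rewrite -(subnK ij); elim: (j - i)%N => // k IHk.
by rewrite addSn; apply: subset_trans IHk; exact: ES.
Qed.

Lemma level_between j J x : (j < J)%N -> (E j `\` E j.+1) x -> level J x = j.
Proof.
move=> + [xEj xEj1]; elim: J => // J IHJ; rewrite ltnS /= => jJ.
rewrite memNset; last by move=> /(chain_sub (jJ : (j.+1 <= J.+1)%N)).
move: jJ; rewrite leq_eqVlt => /predU1P[jE|]; last exact: IHJ.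
by rewrite -jE level_last.
Qed.

Lemma measurable_comp_level (v : nat -> R) J : measurable_fun setT (fun x => v (level J x)).
Proof.
elim: J => [|J IHJ] /=; first exact: measurable_cst.
rewrite (_ : (fun x => _) = fun x => if x \in E J.+1 then v J.+1 else v (level J x)).
  apply: measurable_fun_ifT => //.
  by apply: (measurable_fun_bool true); rewrite setTI preimage_mem_true.
by apply/funext => x; case: ifP.
Qed.

Lemma integral_chain (h : T -> \bar R) i J : (i <= J)%N ->
  measurable_fun setT h -> (forall x, (0 <= h x)%E) ->
  (\int[mu]_(x in E i) h x =
   \sum_(i <= j < J) \int[mu]_(x in E j `\` E j.+1) h x + \int[mu]_(x in E J) h x)%E.
Proof.
move=> iJ mh h0; elim: J iJ => [|J IHJ].
  by rewrite leqn0 => /eqP->; rewrite big_geq// add0e.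
rewrite leq_eqVlt => /predU1P[->|iJ]; first by rewrite big_geq// add0e.
rewrite big_nat_recr//= -addeA IHJ//; congr (_ + _)%E.
by rewrite [LHS](ge0_integral_setDI mu (mE J) (mE J.+1))// setIidr.
Qed.

Lemma integral_level (v : nat -> R) i J : (i <= J)%N -> (forall j, 0 <= v j) ->
  (\int[mu]_(x in E i) (v (level J x))%:E =
   (\sum_(i <= j < J) v j * (m j - m j.+1) + v J * m J)%:E)%E.
Proof.
move=> iJ v0; rewrite (integral_chain iJ); last 2 first.
- by apply/measurable_EFinP; exact: measurable_comp_level.
- by move=> x; rewrite lee_fin.
rewrite EFinD -sumEFin; congr (_ + _)%E.
  apply: eq_big_nat => j /andP[_ jJ]; rewrite -fine_prob_setD// -integral_cst_fine//.
    by apply: eq_integral => x /[!inE] xE; rewrite (level_between jJ xE).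
  exact: measurableD.
rewrite -integral_cst_fine//; apply: eq_integral => x /[!inE] xE.
by rewrite level_last.
Qed.

End chain_levels.

Lemma integral_powR_jensen d (T : measurableType d) (R : realType)
    (mu : probability T R) (W : set T) (X : T -> R) (p b : R) : 1 < p -> 0 <= b ->
  measurable W -> measurable_fun setT X -> (forall x, 0 <= X x) ->
  ((b * fine (mu W))%:E <= \int[mu]_(x in W) (X x)%:E)%E ->
  ((b `^ p * fine (mu W))%:E <= \int[mu]_(x in W) (X x `^ p)%:E)%E.
Proof.
move=> p1 b0 mW mX X0 mean_le.
have p0 : 0 < p by exact: lt_trans p1.
have coef0 : 0 <= p * b `^ (p - 1) by rewrite mulr_ge0 ?powR_ge0 ?ltW.
have cst0 : 0 <= (p - 1) * b `^ p by rewrite mulr_ge0 ?powR_ge0// subr_ge0 ltW.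
have mXW : measurable_fun W X by exact: measurable_funTS.
have mXp : measurable_fun W (fun x => X x `^ p) by exact: measurable_fun_powR.
have young : ((p * b `^ (p - 1))%:E * \int[mu]_(x in W) (X x)%:E <=
    \int[mu]_(x in W) (X x `^ p)%:E + ((p - 1) * b `^ p * fine (mu W))%:E)%E.
  rewrite -(integral_cst_fine mu _ mW) -ge0_integralZl ?lee_fin//; last 2 first.
  - exact/measurable_EFinP.
  - by move=> x _; rewrite lee_fin.
  rewrite -ge0_integralD//; last 2 first.
  - by move=> x _; rewrite lee_fin powR_ge0.
  - exact/measurable_EFinP.
  apply: (ge0_le_integral_EFin mu mW) => [||x].
  - exact: measurable_funM.
  - by apply: measurable_funD.
  - by rewrite mulr_ge0//=; have := powR_young p1 b0 (X0 x); lra.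
have : ((p * b `^ (p - 1))%:E * (b * fine (mu W))%:E <=
    \int[mu]_(x in W) (X x `^ p)%:E + ((p - 1) * b `^ p * fine (mu W))%:E)%E.
  by apply: le_trans young; rewrite lee_wpmul2l ?lee_fin.
rewrite -leeBlDr// -EFinM -EFinB; apply: le_trans; rewrite lee_fin.
by rewrite le_eqVlt; apply/orP; left; rewrite -(mulr_powRB1 b0 p0); apply/eqP; ring.
Qed.

Lemma ge0_is_derive_le (R : realType) (f df : R -> R) (x y : R) : x <= y ->
  (forall t, t \in `[x, y] -> is_derive t (1 : R) f (df t)) ->
  (forall t, t \in `]x, y[ -> 0 <= df t) -> f x <= f y.
Proof.
move=> xy f_df df0.
have derivable_f t : t \in `[x, y] -> derivable f t 1 by move=> /f_df[].
have oo_cc t : t \in `]x, y[ -> t \in `[x, y] by exact: subset_itv_oo_cc.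
apply: (@ger0_derive1_le_cc _ f x y); rewrite ?in_itv/= ?lexx ?xy//.
- by move=> t /oo_cc; exact: derivable_f.
- move=> t txy; have [_ dE] := f_df t (oo_cc t txy).
  by rewrite derive1E dE df0.
- exact: derivable_within_continuous.
Qed.

Lemma powR_lincomb_le (R : realType) (c1 c2 c3 q1 q2 x y : R) : 0 < x -> x <= y ->
  (forall t : R, 0 < t -> 0 <= c1 * (q1 * t `^ (q1 - 1)) + c2 * (q2 * t `^ (q2 - 1)) + c3) ->
  c1 * x `^ q1 + c2 * x `^ q2 + c3 * x <= c1 * y `^ q1 + c2 * y `^ q2 + c3 * y.
Proof.
move=> x0 xy deriv_ge0.
pose psi : R -> R := fun t => c1 * t `^ q1 + c2 * t `^ q2 + c3 * t.
pose dpsi t : R := c1 * (q1 * t `^ (q1 - 1)) + c2 * (q2 * t `^ (q2 - 1)) + c3.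
have psi_dpsi t : t \in `[x, y] -> is_derive t (1 : R) psi (dpsi t).
  rewrite in_itv/= => /andP[/(lt_le_trans x0) t0 _].
  have d1 := is_derive1_powR q1 t0; have d2 := is_derive1_powR q2 t0.
  rewrite /dpsi -[X in _ + X]mulr1.
  exact: (is_deriveD (is_deriveD (is_deriveZ c1 d1) (is_deriveZ c2 d2))
    (is_deriveZ c3 (is_derive_id t 1))).
apply: (ge0_is_derive_le xy psi_dpsi) => t.
by rewrite in_itv/= => /andP[/(lt_trans x0) t0 _]; exact: deriv_ge0.
Qed.

(* Jensen's inequality for the mean of [(1 - a) t^(-a)] over [x < t < y]; the
   monotone combination of powers below is the primitive of the difference of
   the two sides of Young's inequality. *)
Lemma powR_increment_jensen (R : realType) (p a x y : R) :
  1 < p -> 0 <= a -> a * p < 1 -> 0 < x -> x < y ->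
  ((y `^ (1 - a) - x `^ (1 - a)) / (y - x)) `^ p * (y - x) <=
  (1 - a) `^ p / (1 - a * p) * (y `^ (1 - a * p) - x `^ (1 - a * p)).
Proof.
move=> p1 a0 ap x0 xy; set b := (_ / (y - x)).
have p0 : 0 < p by exact: lt_trans p1.
have a1 : 0 <= 1 - a by move: a0 p1 ap; nra.
have yx0 : 0 < y - x by rewrite subr_gt0.
have ap0 : 1 - a * p != 0 by rewrite gt_eqF// subr_gt0.
have b0 : 0 <= b by rewrite divr_ge0 ?(ltW yx0)// subr_ge0 ler_powR2r ?(ltW x0) ?(ltW xy).
have lincomb_le := @powR_lincomb_le R ((1 - a) `^ p / (1 - a * p)) (- (p * b `^ (p - 1)))
  ((p - 1) * b `^ p) (1 - a * p) (1 - a) x y x0 (ltW xy).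
have bE : b * (y - x) = y `^ (1 - a) - x `^ (1 - a) by rewrite divfK ?gt_eqF.
have bpE : b * b `^ (p - 1) = b `^ p by rewrite mulr_powRB1.
have -> : b `^ p * (y - x) = p * b `^ (p - 1) * (b * (y - x)) - (p - 1) * b `^ p * (y - x).
  by rewrite -bpE; ring.
suff deriv_ge0 (t : R) : 0 < t -> 0 <= (1 - a) `^ p / (1 - a * p) *
    ((1 - a * p) * t `^ (1 - a * p - 1)) +
    - (p * b `^ (p - 1)) * ((1 - a) * t `^ (1 - a - 1)) + (p - 1) * b `^ p.
  by rewrite bE; have := lincomb_le deriv_ge0; lra.
move=> t0; have ta0 : 0 <= (1 - a) * t `^ (- a) by rewrite mulr_ge0 ?powR_ge0.
have := powR_young p1 b0 ta0.
rewrite (powRM _ a1 (powR_ge0 _ _)) -powRrM mulNr => young.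
rewrite -[X in X + _ + _]mulrA (mulKf ap0).
have -> : 1 - a * p - 1 = - (a * p) by ring.
have -> : 1 - a - 1 = - a by ring.
by lra.
Qed.

Section power_profile.
Variables (R : realType) (p a : R) (m : nat -> R) (J : nat).
Hypotheses (p1 : 1 < p) (a0 : 0 <= a) (ap : a * p < 1).
Hypotheses (m0 : m 0%N = 1) (m_gt0 : forall j, 0 < m j) (m_ltS : forall j, m j.+1 < m j).

(* The mean of [(1 - a) t^(-a)] over [m j.+1 < t < m j], or over [0 < t < m J]. *)
Definition power_profile j : R := if (j < J)%N
  then (m j `^ (1 - a) - m j.+1 `^ (1 - a)) / (m j - m j.+1) else m J `^ (- a).

Let p0 : 0 < p. Proof. exact: lt_trans p1. Qed.
Let a1 : a < 1. Proof. by move: a0 p1 ap; nra. Qed.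
Let w_gt0 j : 0 < m j - m j.+1. Proof. by rewrite subr_gt0. Qed.

Lemma power_profile_ge0 j : 0 <= power_profile j.
Proof.
rewrite /power_profile; case: ifP => _; last exact: powR_ge0.
by rewrite divr_ge0 ?(ltW (w_gt0 _))// subr_ge0 ler_powR2r ?subr_ge0 ?(ltW a1) ?ltW.
Qed.

Lemma power_profile_le j : power_profile j <= m J `^ (- a).
Proof.
rewrite /power_profile; case: ltnP => // jJ.
have m_anti : {homo m : i k / (i <= k)%N >-> k <= i}.
  by apply: homo_leq => // [x y z xy yz|i]; [exact: le_trans yz xy|exact: ltW].
rewrite ler_pdivrMr//; apply: (@le_trans _ _ ((1 - a) * m j.+1 `^ (1 - a - 1) * (m j - m j.+1))).
  apply: powR_concave_tangent => //; last exact: ltW.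
  by rewrite subr_gt0 a1 gerBl.
rewrite ler_pM2r// addrAC subrr add0r.
apply: (@le_trans _ _ (m j.+1 `^ (- a))); first by rewrite ler_piMl ?powR_ge0// gerBl.
by rewrite !powRN lef_pV2 ?posrE ?powR_gt0// ler_powR2r ?(ltW (m_gt0 _))// m_anti.
Qed.

Lemma power_profile_mean i : (i <= J)%N ->
  \sum_(i <= j < J) power_profile j * (m j - m j.+1) + power_profile J * m J =
  m i `^ (1 - a).
Proof.
move=> iJ; rewrite (@telescope_sumr_eq _ i J (fun j => - m j `^ (1 - a)))//.
  by rewrite {1}/power_profile ltnn powR_mulrD1// opprK addrAC addNr add0r.
move=> j /andP[_ jJ]; rewrite /power_profile jJ divfK ?gt_eqF//.
by rewrite opprK addrC.
Qed.

Lemma power_profile_moment :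
  \sum_(0 <= j < J) power_profile j `^ p * (m j - m j.+1) + power_profile J `^ p * m J <=
  (1 - a) `^ p / (1 - a * p).
Proof.
set c := _ / _.
have ap0 : 0 < 1 - a * p by rewrite subr_gt0.
have c_ge1 : 1 <= c.
  rewrite ler_pdivlMr// mul1r.
  by have := @powR_bernoulli _ p (1 - a) p1; rewrite subr_ge0 => /(_ (ltW a1)); lra.
have last_le : power_profile J `^ p * m J <= c * m J `^ (1 - a * p).
  rewrite /power_profile ltnn -powRrM mulNr powR_mulrD1//.
  by rewrite ler_peMl ?powR_ge0.
have sum_le : \sum_(0 <= j < J) power_profile j `^ p * (m j - m j.+1) <=
    c * (1 - m J `^ (1 - a * p)).
  apply: (@le_trans _ _ (\sum_(0 <= j < J)
      c * (m j `^ (1 - a * p) - m j.+1 `^ (1 - a * p)))).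
    apply: ler_sum_nat => j /andP[_ jJ]; rewrite /power_profile jJ.
    exact: powR_increment_jensen.
  rewrite -mulr_sumr (@telescope_sumr_eq _ 0 J (fun j => - m j `^ (1 - a * p)))//.
    by rewrite m0 powR1 opprK addrC.
  by move=> j _; rewrite opprK addrC.
by lra.
Qed.

Lemma power_sum_lower (r : R) : 0 < r -> (forall j, r * m j <= m j.+1) ->
  r `^ (a * p) * ((1 - m J `^ (1 - a * p)) / (1 - a * p)) <=
  \sum_(0 <= j < J) (m j `^ (- a)) `^ p * (m j - m j.+1).
Proof.
move=> r0 rm; have ap0 : 0 < 1 - a * p by rewrite subr_gt0.
have ap_ge0 : 0 <= a * p by rewrite mulr_ge0// ltW.
have -> : 1 - m J `^ (1 - a * p) =
    \sum_(0 <= j < J) (m j `^ (1 - a * p) - m j.+1 `^ (1 - a * p)).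
  rewrite (@telescope_sumr_eq _ 0 J (fun j => - m j `^ (1 - a * p)))//.
    by rewrite m0 powR1 opprK addrC.
  by move=> j _; rewrite opprK addrC.
rewrite mulr_suml mulr_sumr; apply: ler_sum => j _.
have tangent : (m j `^ (1 - a * p) - m j.+1 `^ (1 - a * p)) / (1 - a * p) <=
    m j.+1 `^ (- (a * p)) * (m j - m j.+1).
  rewrite ler_pdivrMr// [leRHS]mulrC mulrA.
  have -> : m j.+1 `^ (- (a * p)) = m j.+1 `^ (1 - a * p - 1) by congr (_ `^ _); ring.
  apply: powR_concave_tangent => //; last exact: ltW.
  by rewrite ap0 gerBl.
apply: (@le_trans _ _ (r `^ (a * p) * (m j.+1 `^ (- (a * p)) * (m j - m j.+1)))).
  by rewrite ler_wpM2l// powR_ge0.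
rewrite mulrA ler_pM2r// -powRrM mulNr !powRN.
rewrite ler_pdivrMr ?powR_gt0// [leRHS]mulrC ler_pdivlMr ?powR_gt0//.
by rewrite -powRM ?(ltW r0) ?(ltW (m_gt0 _))// ler_powR2r// mulr_ge0 ?ltW.
Qed.

End power_profile.

Section chain_lower_bound.
Context d (T : measurableType d) (R : realType).
Variables (mu : probability T R) (F : nat -> set (set T)).
Hypothesis filF : filtration F.
Variables (p a fv s : R) (J : nat) (E : nat -> set T) (k : nat -> nat).
Hypotheses (p1 : 1 < p) (a0 : 0 <= a) (ap : a * p < 1) (fv0 : 0 <= fv).
Hypotheses (s0 : 0 < s) (s_le : 4 * s <= 1).
(* The error [e] allows for the bound [fv * 2 ^+ J] of the extremal function. *)
Let e := s ^+ 2 / 2 ^+ J.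
Hypothesis chainE : uniform_chain mu F s e E k.
Local Notation m j := (fine (mu (E j))).
Local Notation W j := (E j `\` E j.+1).

Let p0 : 0 < p. Proof. exact: lt_trans p1. Qed.
Let a1 : a < 1. Proof. by move: a0 p1 ap; nra. Qed.
Let ap0 : 0 < 1 - a * p. Proof. by rewrite subr_gt0. Qed.
Let e_le : e <= s ^+ 2.
Proof. by rewrite ler_pdivrMr// ler_peMr ?sqr_ge0// exprn_ege1// ler1n. Qed.

Let E0 : E 0%N = setT. Proof. by case: chainE. Qed.
Let FE j : F (k j) (E j). Proof. by case: chainE => _ /(_ j)[]. Qed.
Let ES j : E j.+1 `<=` E j. Proof. by case: chainE => _ /(_ j)[]. Qed.
Let mE j : measurable (E j). Proof. exact: filtration_measurable (FE j). Qed.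
Let mW j : measurable (W j). Proof. exact: measurableD. Qed.
Let m_gt0 j : 0 < m j. Proof. by case: chainE => _ /(_ j)[]. Qed.
Let m0 : m 0%N = 1. Proof. by rewrite E0 fine_prob_setT. Qed.
Let shareW j : uniform_share mu (F (k j)) s (e * m j) (E j) (W j).
Proof. by case: chainE => _ /(_ j)[]. Qed.
Let wE j : fine (mu (W j)) = m j - m j.+1. Proof. exact: fine_prob_setD. Qed.

Let w_bounds j : (s - s ^+ 2) * m j <= m j - m j.+1 <= (s + s ^+ 2) * m j.
Proof.
have := shareW (G_setT (filtration_sigma filF (k j))); rewrite !setIT wE ler_norml.
have : e * m j <= s ^+ 2 * m j by rewrite ler_pM2r.
move: (m j) (m j.+1) (e * m j) => x y z ez /andP[? ?].
by apply/andP; split; lra.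
Qed.

Let s_sqr : s ^+ 2 <= s / 4. Proof. by move: s0 s_le; nra. Qed.

Let m_le j : m j.+1 <= (1 - s / 2) * m j.
Proof.
have /andP[+ _] := w_bounds j; have := m_gt0 j; have := s_sqr.
by move: (m j) (m j.+1) => x y; nra.
Qed.

Let m_ge j : (1 - 2 * s) * m j <= m j.+1.
Proof.
have /andP[_] := w_bounds j; have := m_gt0 j; have := s_sqr.
by move: (m j) (m j.+1) => x y; nra.
Qed.

Let m_ltS j : m j.+1 < m j.
Proof. by apply: le_lt_trans (m_le j) _; rewrite gtr_pMl// gtrBl divr_gt0. Qed.

Let m_le1 j : m j <= 1.
Proof. by rewrite -m0; apply: le_fine_prob => //; exact: chain_sub. Qed.

Let m_le_expr j : m j <= (1 - s / 2) ^+ j.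
Proof.
elim: j => [|j IHj]; first by rewrite m0.
apply: le_trans (m_le j) _; rewrite exprS ler_wpM2l//.
by move: s_le; lra.
Qed.

Let m_ge_expr j : 2^-1 ^+ j <= m j.
Proof.
elim: j => [|j IHj]; first by rewrite m0.
apply: le_trans (m_ge j); rewrite exprS ler_pM ?exprn_ge0//.
by move: s_le; lra.
Qed.

Let profile := power_profile a (fun j => m j) J.
Let profile0 j : 0 <= profile j. Proof. exact: power_profile_ge0 p1 a0 ap _ _ _. Qed.

Let extremal x := fv * profile (level E J x).
Let extremal_moment :=
  fv `^ p * (\sum_(0 <= j < J) profile j `^ p * (m j - m j.+1) + profile J `^ p * m J).

Let m_extremal : measurable_fun setT extremal.
Proof. by apply: measurable_funM => //; exact: measurable_comp_level. Qed.

Let extremal_bounds x : 0 <= extremal x <= fv * 2 ^+ J.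
Proof.
rewrite mulr_ge0//= ler_wpM2l//.
apply: le_trans (power_profile_le J p1 a0 ap m_gt0 m_ltS _) _.
apply: (@le_trans _ _ (m J)^-1).
  rewrite powRN lef_pV2 ?posrE ?powR_gt0//.
  by apply: ger1_powR; rewrite ?m_gt0 ?m_le1 ?(ltW a1).
by rewrite -[leRHS]invrK lef_pV2 ?posrE ?invr_gt0// -exprVn.
Qed.

Let integral_extremal j : (j <= J)%N ->
  (\int[mu]_(x in E j) (extremal x)%:E = (fv * m j `^ (1 - a))%:E)%E.
Proof.
move=> jJ; rewrite (@integral_level _ _ _ mu E mE ES (fun i => fv * profile i) j J jJ).
  congr EFin; rewrite -(power_profile_mean a m_gt0 m_ltS jJ) mulrDr mulr_sumr.
  congr (_ + _); last by rewrite mulrA.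
  by apply: eq_bigr => i _; rewrite mulrA.
by move=> i; rewrite mulr_ge0.
Qed.

Let extremal_has_moments : has_moments mu p extremal_moment fv extremal.
Proof.
split=> // [x||].
- by have /andP[] := extremal_bounds x.
- rewrite -E0 (@integral_level _ _ _ mu E mE ES (fun i => (fv * profile i) `^ p) 0 J (leq0n J)).
    congr EFin; rewrite /extremal_moment mulrDr mulr_sumr powRM// mulrA; congr (_ + _).
    by apply: eq_bigr => i _; rewrite powRM// mulrA.
  by move=> i; exact: powR_ge0.
- by rewrite -E0 integral_extremal// m0 powR1 mulr1.
Qed.

Let extremal_moment_le : extremal_moment <= fv `^ p * ((1 - a) `^ p / (1 - a * p)).
Proof.
by rewrite ler_wpM2l ?powR_ge0//; exact: power_profile_moment p1 a0 ap m0 m_gt0 m_ltS.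
Qed.

Section maximal_function_of_extremal.
Variable fn : nat -> T -> R.
Hypotheses (fnE : cond_exps mu F extremal fn) (fn0 : forall n x, 0 <= fn n x).

Let mfn n : measurable_fun setT (fn n).
Proof. by have [_ /measurable_int/measurable_EFinP] := fnE n. Qed.

Let mean_on_share j : (j < J)%N ->
  ((fv * (1 - 2 * s) * m j `^ (- a) * fine (mu (W j)))%:E <=
   \int[mu]_(x in W j) (fn (k j) x)%:E)%E.
Proof.
move=> jJ.
have K0 : 0 <= fv * 2 ^+ J by rewrite mulr_ge0// ltW.
have := condexp_share_lower (filtration_sigma filF (k j))
  (@filtration_measurable _ _ F filF (k j)) (FE j) (mW j) (@subDsetl _ _ _) (@shareW j)
  (ltW s0) K0 m_extremal extremal_bounds (fn0 (k j)) (fnE (k j)).1.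
rewrite (integral_extremal (ltnW jJ)) -EFinM -leeBlDr// -EFinB; apply: le_trans.
rewrite lee_fin wE.
have -> : fv * 2 ^+ J * (e * m j) = fv * s ^+ 2 * m j.
  by rewrite /e; field; rewrite gt_eqF.
have m_le_pow : m j <= m j `^ (1 - a).
  by apply: ger1_powR; rewrite ?m_gt0 ?m_le1// gerBl.
apply: (@le_trans _ _ (fv * (1 - 2 * s) * m j `^ (- a) * ((s + s ^+ 2) * m j))).
  rewrite ler_wpM2l ?mulr_ge0 ?powR_ge0//; first by move: s_le; lra.
  by have /andP[] := w_bounds j.
rewrite [leLHS](_ : _ = fv * ((1 - 2 * s) * (s + s ^+ 2) * (m j `^ (- a) * m j))); last by ring.
rewrite powR_mulrD1// [leRHS](_ : _ = fv * (s * m j `^ (1 - a) - s ^+ 2 * m j)); last by ring.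
rewrite ler_wpM2l//.
have : s ^+ 2 * m j <= s ^+ 2 * m j `^ (1 - a) by rewrite ler_wpM2l ?sqr_ge0.
have : 0 <= s ^+ 3 * m j `^ (1 - a) by rewrite mulr_ge0 ?powR_ge0// exprn_ge0// ltW.
by move: (m j `^ (1 - a)) => x; lra.
Qed.

Let maximal_on_share j : (j < J)%N ->
  (((fv * (1 - 2 * s)) `^ p * ((m j `^ (- a)) `^ p * (m j - m j.+1)))%:E <=
   \int[mu]_(x in W j) (maxfun fn x `^ p))%E.
Proof.
move=> jJ; have c0 : 0 <= fv * (1 - 2 * s) by rewrite mulr_ge0//; move: s_le; lra.
have mean0 : 0 <= fv * (1 - 2 * s) * m j `^ (- a) by rewrite mulr_ge0 ?powR_ge0.
have := integral_powR_jensen p1 mean0 (mW j) (mfn (k j)) (fn0 (k j)) (mean_on_share jJ).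
rewrite powRM ?powR_ge0// -mulrA wE => /le_trans; apply.
apply: ge0_le_integral => //.
- by move=> x _; rewrite lee_fin powR_ge0.
- by apply/measurable_EFinP/measurable_fun_powR; exact: measurable_funTS.
- by apply: measurable_fun_poweR; apply: measurable_funTS; exact: measurable_maxfun.
- move=> x _; rewrite -poweR_EFin lee_poweR2r ?(ltW p0) ?lee_fin//.
  by apply: le_trans (maxfun_ge fn (k j) x); rewrite lee_fin ler_norm.
Qed.

Lemma integral_maxfun_extremal_lower :
  (((fv * (1 - 2 * s)) `^ p * ((1 - 2 * s) `^ (a * p) *
      ((1 - m J `^ (1 - a * p)) / (1 - a * p))))%:E <=
   \int[mu]_x (maxfun fn x `^ p))%E.
Proof.
have mmax : measurable_fun setT (fun x => maxfun fn x `^ p)%E.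
  by apply: measurable_fun_poweR; exact: measurable_maxfun.
have max0 x : (0 <= maxfun fn x `^ p)%E by exact: poweR_ge0.
rewrite -[X in integral _ X _]E0 (integral_chain mu mE ES (leq0n J) mmax max0).
apply: (@le_trans _ _ (\sum_(0 <= j < J)
    \int[mu]_(x in W j) (maxfun fn x `^ p))%E); last by rewrite leeDl// integral_ge0.
apply: (@le_trans _ _ (\sum_(0 <= j < J)
    ((fv * (1 - 2 * s)) `^ p * ((m j `^ (- a)) `^ p * (m j - m j.+1)))%:E)%E); last first.
  by rewrite !big_mkord; apply: lee_sum => j _; exact: maximal_on_share.
rewrite sumEFin lee_fin -mulr_sumr ler_wpM2l ?powR_ge0//.
by apply: power_sum_lower => //; move: s_le; lra.
Qed.

End maximal_function_of_extremal.

Lemma Btilde_chain_lower : exists2 F0 : R, F0 <= fv `^ p * ((1 - a) `^ p / (1 - a * p)) &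
  (((fv * (1 - 2 * s)) `^ p * ((1 - 2 * s) `^ (a * p) *
      ((1 - ((1 - s / 2) `^ (1 - a * p)) ^+ J) / (1 - a * p))))%:E <=
   Btilde mu F p F0 fv)%E.
Proof.
exists extremal_moment; first exact: extremal_moment_le.
have [_ extremal0 _ int_extremal] := extremal_has_moments.
have [|fn fnE fn0] := cond_exps_exists filF extremal0 (mu := mu).
  by apply: ge0_integrable; rewrite // int_extremal ltry.
apply: (@le_trans _ _ (\int[mu]_x (maxfun fn x `^ p))%E); last first.
  by apply: ereal_sup_ubound; exists extremal, fn.
apply: le_trans (integral_maxfun_extremal_lower fnE fn0); rewrite lee_fin.
rewrite ler_wpM2l ?powR_ge0// ler_wpM2l ?powR_ge0// ler_pM2r ?invr_gt0// lerD2l lerN2.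
have base0 : 0 <= 1 - s / 2 by move: s_le; lra.
rewrite -powR_mulrn ?powR_ge0// powRAC powR_mulrn//.
by rewrite ler_powR2r ?(ltW ap0) ?(ltW (m_gt0 J)).
Qed.

End chain_lower_bound.

(** * The explicit value *)

Lemma lipschitz_within_continuous (R : realType) (A : set R) (f : R -> R) (L : R) :
  (forall x y, A x -> A y -> `|f x - f y| <= L * `|x - y|) ->
  {within A, continuous f}.
Proof.
move=> lip; apply/subspace_continuousP => x Ax; apply/cvgrPdist_le => eps eps0.
have : \forall y \near x, `|x - y| <= eps / (`|L| + 1).
  by apply/nbhs_ballP; exists (eps / (`|L| + 1)) => /=; [exact: divr_gt0|move=> y /= /ltW].
apply: filterS => y xy Ay; apply: le_trans (lip x y Ax Ay) _.
apply: (@le_trans _ _ ((`|L| + 1) * (eps / (`|L| + 1)))); last by rewrite mulrC divfK ?gt_eqF.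
apply: (@le_trans _ _ ((`|L| + 1) * `|x - y|)).
  by rewrite ler_wpM2r// (le_trans (ler_norm L))// lerDl.
by rewrite ler_wpM2l// ltW.
Qed.

Lemma powR_add_le (R : realType) (p x y : R) : 0 <= p -> 0 <= x -> 0 <= y ->
  (x + y) `^ p <= 2 `^ p * x `^ p + 2 `^ p * y `^ p.
Proof.
move=> p0 x0 y0; wlog xy : x y x0 y0 / x <= y.
  by move=> le_xy; have [/le_xy->//|/ltW/le_xy yx] := leP x y; rewrite addrC [leRHS]addrC yx.
apply: (@le_trans _ _ ((2 * y) `^ p)).
  by rewrite ler_powR2r ?addr_ge0// mulrDl !mul1r lerD2r.
by rewrite powRM// lerDr mulr_ge0 ?powR_ge0.
Qed.

Section mixing_with_indicator.
Context d (T : measurableType d) (R : realType).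
Variables (mu : probability T R) (F : nat -> set (set T)).
Hypothesis filF : filtration F.
Variables (p F0 Fv fv : R) (f : T -> R) (fn : nat -> T -> R) (B : set T).
Hypotheses (p1 : 1 < p) (fv0 : 0 < fv) (F0_le : F0 <= Fv).
Hypotheses (f_moments : has_moments mu p F0 fv f) (fnE : cond_exps mu F f fn).
Hypotheses (fn0 : forall n x, 0 <= fn n x) (mB : measurable B).
Local Notation b := (fine (mu B)).
Hypothesis b0 : 0 < b.

Let p0 : 0 < p. Proof. exact: lt_trans p1. Qed.
Let p_ge0 := ltW p0.
Let mf : measurable_fun setT f. Proof. by case: f_moments. Qed.
Let f0 x : 0 <= f x. Proof. by case: f_moments. Qed.

Let g x : R := fv / b * \1_B x.
Let g0 x : 0 <= g x. Proof. by rewrite mulr_ge0// divr_ge0// ltW. Qed.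
Let mg : measurable_fun setT g.
Proof. by apply: measurable_funM => //; exact: measurable_indic. Qed.

Let gpE x : g x `^ p = (fv / b) `^ p * \1_B x.
Proof.
rewrite /g powRM ?divr_ge0 ?(ltW fv0) ?(ltW b0)//; congr (_ * _).
by rewrite indicE; case: (_ \in _); rewrite ?powR1// powR0// gt_eqF.
Qed.

Let integral_mul_indic (c : R) : 0 <= c -> (\int[mu]_x (c * \1_B x)%:E = (c * b)%:E)%E.
Proof.
move=> c0; under eq_integral do rewrite EFinM.
rewrite ge0_integralZl ?lee_fin//; last by apply/measurable_EFinP; exact: measurable_indic.
by rewrite integral_indic_fine// setIT.
Qed.

Let int_g : (\int[mu]_x (g x)%:E = fv%:E)%E.
Proof.
by rewrite integral_mul_indic ?divfK ?gt_eqF// divr_ge0// ltW.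
Qed.

Let mix t x := (1 - t) * f x + t * g x.

Let m_mix t : measurable_fun setT (mix t).
Proof. by apply: measurable_funD; exact: measurable_funM. Qed.

Let mix_bounds t x : 0 <= t <= 1 -> 0 <= mix t x <= f x + g x.
Proof.
move=> /andP[t0 t1]; rewrite addr_ge0 1?mulr_ge0 ?subr_ge0//=.
by apply: lerD; [rewrite ler_piMl// gerBl|rewrite ler_piMl].
Qed.

Let mfgp : measurable_fun setT (fun x => (f x + g x) `^ p).
Proof. by apply: measurable_fun_powR; exact: measurable_funD. Qed.

Let int_fgp_fin : (\int[mu]_x ((f x + g x) `^ p)%:E)%E \is a fin_num.
Proof.
rewrite ge0_fin_numE; last by apply: integral_ge0 => x _; rewrite lee_fin powR_ge0.
apply: (@le_lt_trans _ _
    (\int[mu]_x (2 `^ p * f x `^ p + 2 `^ p * g x `^ p)%:E)%E).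
  apply: ge0_le_integral_EFin => // [|x].
    by apply: measurable_funD; apply: measurable_funM => //; exact: measurable_fun_powR.
  by rewrite powR_ge0 powR_add_le.
rewrite ge0_integral_lincomb ?powR_ge0//;
  do ?[exact: measurable_fun_powR|by move=> x; exact: powR_ge0].
have [_ _ -> _] := f_moments; under [X in (_ + _ * X)%E]eq_integral do rewrite gpE.
by rewrite integral_mul_indic ?powR_ge0// -!EFinM -EFinD ltry.
Qed.

Let mix_moment_fin t : 0 <= t <= 1 -> (\int[mu]_x (mix t x `^ p)%:E)%E \is a fin_num.
Proof.
move=> t01; rewrite ge0_fin_numE; last by apply: integral_ge0 => x _; rewrite lee_fin powR_ge0.
apply: le_lt_trans (_ : _ <= \int[mu]_x ((f x + g x) `^ p)%:E)%E _; last first.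
  by rewrite ltey_eq int_fgp_fin.
apply: ge0_le_integral_EFin => // [|x]; first exact: measurable_fun_powR.
have /andP[mix0 mix_le] := mix_bounds x t01.
by rewrite powR_ge0 ler_powR2r.
Qed.

Let mix_moment_lipschitz t u : 0 <= t <= 1 -> 0 <= u <= 1 ->
  (\int[mu]_x (mix t x `^ p)%:E <= \int[mu]_x (mix u x `^ p)%:E +
     (p * `|t - u|)%:E * \int[mu]_x ((f x + g x) `^ p)%:E)%E.
Proof.
move=> t01 u01; rewrite -[X in (_ <= X + _)%E]mul1e.
have mmixp v : measurable_fun setT (fun x => mix v x `^ p) by exact: measurable_fun_powR.
rewrite -ge0_integral_lincomb ?mulr_ge0//; do ?by move=> x; exact: powR_ge0.
apply: ge0_le_integral_EFin => // [|x].
  by apply: measurable_funD; exact: measurable_funM.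
have /andP[mixt0 mixt_le] := mix_bounds x t01.
have /andP[mixu0 _] := mix_bounds x u01.
have fg0 : 0 <= f x + g x by rewrite addr_ge0.
rewrite powR_ge0 mul1r/= -lerBlDl.
have := powR_tangent p1 mixt0 mixu0.
have diff_le : mix t x - mix u x <= `|t - u| * (f x + g x).
  have -> : mix t x - mix u x = (t - u) * g x + (u - t) * f x by rewrite /mix; ring.
  rewrite mulrDr [leRHS]addrC lerD// ler_wpM2r//; first exact: ler_norm.
  by rewrite distrC; exact: ler_norm.
have pow_le : mix t x `^ (p - 1) * (f x + g x) <= (f x + g x) `^ p.
  by rewrite -(mulr_powRB1 fg0 p0) mulrC ler_wpM2l// ler_powR2r// subr_ge0 ltW.
have : mix t x `^ (p - 1) * (mix t x - mix u x) <= `|t - u| * (f x + g x) `^ p.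
  apply: le_trans (ler_wpM2l (powR_ge0 _ _) diff_le) _.
  by rewrite mulrCA ler_wpM2l.
by rewrite -(ler_pM2l p0); lra.
Qed.

Let mix_moment_ge t : 0 <= t <= 1 ->
  (((t * (fv / b)) `^ p * b)%:E <= \int[mu]_x (mix t x `^ p)%:E)%E.
Proof.
move=> /andP[t0 t1]; have c0 : 0 <= fv / b by rewrite divr_ge0 ?ltW.
rewrite -integral_mul_indic ?powR_ge0//; apply: ge0_le_integral_EFin => // [||x].
- by apply: measurable_funM => //; exact: measurable_indic.
- exact: measurable_fun_powR.
rewrite mulr_ge0 ?powR_ge0//= powRM// -mulrA -gpE -powRM//.
by rewrite ler_powR2r// 1?mulr_ge0// lerDr mulr_ge0// subr_ge0.
Qed.

Let mix_moment0 : (\int[mu]_x (mix 0 x `^ p)%:E = F0%:E)%E.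
Proof.
have [_ _ <- _] := f_moments; apply: eq_integral => x _.
by rewrite /mix subr0 mul1r mul0r addr0.
Qed.

Let exists_mix s : 0 <= s <= 1 -> Fv <= (s * (fv / b)) `^ p * b ->
  exists2 t, 0 <= t <= s & has_moments mu p Fv fv (mix t).
Proof.
move=> s01 Fv_le; have /andP[s0 s1] := s01.
have [M ME] : exists M : R -> R, forall t, 0 <= t <= 1 ->
    (\int[mu]_x (mix t x `^ p)%:E = (M t)%:E)%E.
  exists (fun t => fine (\int[mu]_x (mix t x `^ p)%:E)%E) => t t01.
  by rewrite (fineK (mix_moment_fin t01)).
have M0 : M 0 = F0 by apply: EFin_inj; rewrite -(ME 0) ?mix_moment0// lexx ler01.
have Ms : Fv <= M s by rewrite (le_trans Fv_le)// -lee_fin -(ME _ s01) mix_moment_ge.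
pose L := p * fine (\int[mu]_x ((f x + g x) `^ p)%:E)%E.
have M_lip t u : 0 <= t <= 1 -> 0 <= u <= 1 -> M t - M u <= L * `|t - u|.
  move=> t01 u01; rewrite lerBlDl -lee_fin /L [p * _ * _]mulrAC EFinD EFinM.
  by rewrite (fineK int_fgp_fin) -(ME _ t01) -(ME _ u01) mix_moment_lipschitz.
have cont : {within `[0, s], continuous M}.
  apply: (lipschitz_within_continuous (L := L)) => t u; rewrite /= !in_itv/=.
  move=> /andP[t0 ts] /andP[u0 us].
  have t01 : 0 <= t <= 1 by rewrite t0 (le_trans ts).
  have u01 : 0 <= u <= 1 by rewrite u0 (le_trans us).
  rewrite ler_norml M_lip// andbT lerNl opprB distrC.
  exact: M_lip.
have [|t] := @IVT _ M 0 s Fv s0 cont.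
  by rewrite ge_min M0 F0_le le_max Ms orbT.
rewrite in_itv/= => t0s tE; exists t => //; have /andP[t0 ts] := t0s.
have t01 : 0 <= t <= 1 by rewrite t0 (le_trans ts).
split=> // [x||]; first by have /andP[] := mix_bounds x t01.
  by rewrite ME// tE.
have [_ _ _ int_f] := f_moments.
rewrite ge0_integral_lincomb ?subr_ge0//; last by have /andP[] := t01.
by rewrite int_f int_g -!EFinM -EFinD; congr EFin; ring.
Qed.

Lemma mixed_maximal_le_Btilde s : 0 <= s < 1 -> Fv <= (s * (fv / b)) `^ p * b ->
  (((1 - s) `^ p)%:E * \int[mu]_x (maxfun fn x `^ p) <= Btilde mu F p Fv fv)%E.
Proof.
move=> /andP[s0 s1] Fv_le; have s01 : 0 <= s <= 1 by rewrite s0 ltW.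
have [t /andP[t0 ts] mix_moments] := exists_mix s01 Fv_le.
have t1 : t <= 1 := le_trans ts (ltW s1).
have integrable_fin (h : T -> R) c : measurable_fun setT h -> (forall x, 0 <= h x) ->
    (\int[mu]_x (h x)%:E = c%:E)%E -> mu.-integrable setT (EFin \o h).
  by move=> mh h0 int_h; apply: ge0_integrable => //; rewrite int_h ltry.
have [_ _ _ int_f] := f_moments.
have if_ := integrable_fin f fv mf f0 int_f; have ig := integrable_fin g fv mg g0 int_g.
have [gn gnE gn0] := cond_exps_exists filF g0 ig.
pose hn n x := (1 - t) * fn n x + t * gn n x.
have hnE : cond_exps mu F (mix t) hn.
  move=> n; have [[fnE_n ifn] [gnE_n ign]] := (fnE n, gnE n); split.
    apply: condexp_lincomb => //; first exact: filtration_sigma.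
    exact: filtration_measurable.
  rewrite (_ : EFin \o hn n = fun x => (1 - t)%:E * (EFin \o fn n) x + t%:E * (EFin \o gn n) x)%E//.
  by apply: integrableD => //; exact: integrableZl.
have mfn n : measurable_fun setT (fn n).
  by have [_ /measurable_int/measurable_EFinP] := fnE n.
have mhn n : measurable_fun setT (hn n).
  by have [_ /measurable_int/measurable_EFinP] := hnE n.
apply: (@le_trans _ _ (\int[mu]_x (maxfun hn x `^ p))%E); last first.
  by apply: ereal_sup_ubound; exists (mix t), hn.
rewrite -ge0_integralZl ?lee_fin ?powR_ge0//; last 2 first.
- by apply: measurable_fun_poweR; exact: measurable_maxfun.
- by move=> x _; exact: poweR_ge0.
apply: ge0_le_integral => //.
- by move=> x _; rewrite mule_ge0 ?poweR_ge0 ?lee_fin ?powR_ge0.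
- by apply/measurable_funeM/measurable_fun_poweR; exact: measurable_maxfun.
- by apply: measurable_fun_poweR; exact: measurable_maxfun.
move=> x _; rewrite -poweR_EFin -poweRM ?lee_fin ?subr_ge0 ?(ltW s1) ?maxfun_ge0//.
apply: lee_poweR2r; rewrite ?mule_ge0 ?maxfun_ge0 ?lee_fin ?subr_ge0 ?(ltW s1)//.
rewrite -lee_pdivlMl ?subr_gt0//; apply/maxfun_leP => n.
rewrite lee_pdivlMl ?subr_gt0//; apply: le_trans (maxfun_ge hn n x).
rewrite -EFinM lee_fin !ger0_norm ?addr_ge0 1?mulr_ge0 ?subr_ge0//.
by rewrite ler_wpDr ?mulr_ge0// ler_wpM2r// lerD2l lerN2.
Qed.

End mixing_with_indicator.

Section common_value.
Context d (T : measurableType d) (R : realType).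
Variables (mu : probability T R) (F : nat -> set (set T)).
Hypotheses (filF : filtration F) (irF : inf_refining mu F).
Variables (p fv : R).
Hypotheses (p1 : 1 < p) (fv0 : 0 < fv).

Let p0 : 0 < p. Proof. exact: lt_trans p1. Qed.

Let exists_concentration_set s Fv : 0 < s -> exists2 B, measurable B &
  0 < fine (mu B) /\ Fv <= (s * (fv / fine (mu B))) `^ p * fine (mu B).
Proof.
move=> s0; have q0 : 0 < p - 1 by rewrite subr_gt0.
pose ratio := (s * fv) `^ p / (`|Fv| + 1).
have ratio0 : 0 < ratio by rewrite divr_gt0// powR_gt0// mulr_gt0.
have [B mB /andP[b0 b_le]] := refining_small_set filF irF (powR_gt0 (p - 1)^-1 ratio0).
exists B => //; split=> //; set b := fine (mu B) in b0 b_le *.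
have b_pow_le : b `^ (p - 1) <= ratio.
  have -> : ratio = (ratio `^ (p - 1)^-1) `^ (p - 1).
    by rewrite -powRrM mulVf ?gt_eqF// powRr1// ltW.
  by apply: ler_powR2r => //; exact: ltW.
rewrite -(ler_pM2r (powR_gt0 (p - 1) b0)) -mulrA (mulr_powRB1 (ltW b0) p0).
rewrite -powRM ?mulr_ge0 ?invr_ge0 ?(ltW s0) ?(ltW fv0) ?(ltW b0)// -mulrA divfK ?gt_eqF//.
apply: le_trans (ler_wpM2r (powR_ge0 _ _) (ler_norm Fv)) _.
apply: le_trans (ler_wpM2l (normr_ge0 Fv) b_pow_le) _.
rewrite /ratio mulrA ler_pdivrMr// mulrC ler_wpM2l ?powR_ge0//.
by rewrite lerDl.
Qed.

Lemma Btilde_nondecreasing F0 Fv : F0 <= Fv ->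
  (Btilde mu F p F0 fv <= Btilde mu F p Fv fv)%E.
Proof.
move=> F0_le; apply: ge_ereal_sup => _ [f [fn [f_moments fnE ->]]].
have [_ f0 _ _] := f_moments; have absE := cond_exps_abs filF f0 fnE.
rewrite -maxfun_abs; apply/lee_mul01Pr; first by apply: integral_ge0 => x _; exact: poweR_ge0.
move=> r /andP[r0 r1]; pose s := 1 - r `^ p^-1.
have sE : (1 - s) `^ p = r.
  by rewrite /s opprB addrCA subrr addr0 -powRrM mulVf ?gt_eqF// powRr1 ?ltW.
have s1 : s < 1 by rewrite gtrBl powR_gt0.
have s0 : 0 < s by rewrite subr_gt0 powR_lt1 ?invr_gt0// ltW.
have [B mB [b0 Fv_le]] := exists_concentration_set Fv s0.
rewrite -[X in X%:E]sE.
by apply: (mixed_maximal_le_Btilde filF p1 fv0 F0_le f_moments absE _ mB b0 _ Fv_le);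
  rewrite // (ltW s0).
Qed.

Section extremal_value.
Variable a : R.
Hypotheses (a0 : 0 <= a) (ap : a * p < 1).
Local Notation Fv := (fv `^ p * ((1 - a) `^ p / (1 - a * p))).

Let chain_value s : R := (fv * (1 - 2 * s)) `^ p * ((1 - 2 * s) `^ (a * p) / (1 - a * p)).

Let chain_value_le i : (1 < i)%N ->
  ((chain_value (2^-1 ^+ i))%:E <= Btilde mu F p Fv fv)%E.
Proof.
case: i => [|[|i]]// _; set s := 2^-1 ^+ i.+2; have s0 : 0 < s by rewrite exprn_gt0// invr_gt0.
have s_le : 4 * s <= 1.
  rewrite /s !exprS; have : (2^-1 : R) ^+ i <= 1 by rewrite exprn_ile1 ?invr_ge0 ?invf_le1 ?ler1n.
  by lra.
pose bound J := chain_value s * (1 - ((1 - s / 2) `^ (1 - a * p)) ^+ J).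
have bound_le J : ((bound J)%:E <= Btilde mu F p Fv fv)%E.
  have e0 : 0 < s ^+ 2 / 2 ^+ J by rewrite divr_gt0// exprn_gt0.
  have share_lt1 : s + s ^+ 2 / 2 ^+ J < 1.
    apply: (@le_lt_trans _ _ (s + s ^+ 2)); last by rewrite expr2; nra.
    by rewrite lerD2l ler_pdivrMr ?exprn_gt0// ler_peMr ?sqr_ge0// exprn_ege1// ler1n.
  have [E [k chainE]] := refining_chain filF irF e0 share_lt1.
  have [F0 F0_le lower] := Btilde_chain_lower filF p1 a0 ap (ltW fv0) s0 s_le chainE.
  apply: le_trans (Btilde_nondecreasing F0_le); apply: le_trans lower.
  by rewrite /bound /chain_value lee_fin -!mulrA (mulrC (1 - a * p)^-1).
have bound_cvg : bound J @[J --> \oo] --> chain_value s.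
  rewrite -[X in _ --> X]mulr1 -[X in _ * X]subr0.
  apply: cvgM; first exact: cvg_cst.
  apply: cvgB; first exact: cvg_cst.
  apply: cvg_expr; rewrite ger0_norm ?powR_ge0//.
  by apply: powR_lt1; rewrite ?subr_gt0//; lra.
by apply: (cvge_to_le (cvg_comp_EFin _ bound_cvg)); exact: nearW.
Qed.

Lemma Btilde_lower : ((fv `^ p / (1 - a * p))%:E <= Btilde mu F p Fv fv)%E.
Proof.
have half_cvg : (2^-1 : R) ^+ i @[i --> \oo] --> 0.
  by apply: cvg_expr; rewrite ger0_norm ?invr_ge0// invf_lt1// ltr1n.
have shrink_cvg (c : R) : c * (1 - 2 * 2^-1 ^+ i) @[i --> \oo] --> c.
  rewrite -[X in _ --> X](_ : c * (1 - 2 * 0) = c); last by rewrite mulr0 subr0 mulr1.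
  apply: cvgM; first exact: cvg_cst.
  by apply: cvgB; [exact: cvg_cst|apply: cvgM => //; exact: cvg_cst].
have value_cvg : chain_value (2^-1 ^+ i) @[i --> \oo] --> fv `^ p / (1 - a * p).
  rewrite -[X in _ --> X](_ : fv `^ p * (1 `^ (a * p) / (1 - a * p)) = _); last first.
    by rewrite powR1 mul1r.
  apply: cvgM.
    exact: cvg_powR.
  apply: cvgM; last exact: cvg_cst.
  have := shrink_cvg 1; under eq_fun do rewrite mul1r.
  exact: cvg_powR.
by apply: (cvge_to_le (cvg_comp_EFin _ value_cvg)); exists 2%N.
Qed.

Lemma Btilde_extremal : Btilde mu F p Fv fv = (fv `^ p / (1 - a * p))%:E.
Proof.
apply/eqP; rewrite eq_le Btilde_lower andbT; have fvp0 : 0 <= fv `^ p by exact: powR_ge0.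
have [a_gt0|a_le0] := ltP 0 a; first by apply: Btilde_upper => //; exact: ltW.
have a_eq0 : a = 0 by apply/eqP; rewrite eq_le a_le0.
have := Btilde_lower; rewrite a_eq0 mul0r !subr0 powR1 !divr1 mulr1 => lower.
apply/lee_mul01Pr => [|r /andP[r0 r1]]; first by rewrite (le_trans _ lower)// lee_fin.
have small0 : 0 < (1 - r) / p by rewrite divr_gt0// subr_gt0.
have smallE : 1 - (1 - r) / p * p = r by rewrite divfK ?gt_eqF//; ring.
rewrite -lee_pdivlMl// -EFinM mulrC -[X in _ / X]smallE.
apply: Btilde_upper => //; first by rewrite -subr_gt0 smallE.
  exact: ltW.
rewrite ler_peMr// smallE ler_pdivlMr// mul1r.
have small_le1 : (1 - r) / p <= 1.
  by rewrite ler_pdivrMr// mul1r (le_trans _ (ltW p1))// gerBl ltW.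
have := powR_bernoulli p1 (_ : 0 <= 1 - (1 - r) / p); rewrite subr_ge0 => /(_ small_le1).
by lra.
Qed.

End extremal_value.

End common_value.

Lemma extremal_ratio_surj (R : realType) (p t : R) : 1 < p -> 1 <= t ->
  exists a, [/\ 0 <= a, a * p < 1 & (1 - a) `^ p / (1 - a * p) = t].
Proof.
move=> p1 t1; have p0 : 0 < p by exact: lt_trans p1.
have pV1 : p^-1 < 1 by rewrite invf_lt1.
pose psi (a : R) := (1 - a) `^ p - t * (1 - a * p).
have psi_cont : {within `[0, p^-1], continuous psi}.
  apply: continuous_in_subspaceT => a; rewrite inE/= in_itv/= => /andP[_ a_le].
  have idB (c : R) : (1 - y * c) @[y --> a] --> 1 - a * c.
    by apply: cvgB; [exact: cvg_cst|apply: cvgM; [exact: cvg_id|exact: cvg_cst]].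
  apply: cvgB; last by apply: cvgM; [exact: cvg_cst|exact: idB].
  have := idB 1; under eq_fun do rewrite mulr1; rewrite mulr1.
  by apply: cvg_powR; rewrite subr_gt0 (le_lt_trans a_le).
have psi0 : psi 0 <= 0 by rewrite /psi mul0r !subr0 powR1 mulr1 subr_le0.
have psi1 : 0 < psi p^-1.
  by rewrite /psi mulVf ?gt_eqF// subrr mulr0 subr0 powR_gt0// subr_gt0.
have [||a] := @IVT _ psi 0 p^-1 0 _ psi_cont.
- by rewrite invr_ge0 ltW.
- by rewrite ge_min psi0 le_max (ltW psi1) orbT.
rewrite in_itv/= => /andP[a0 a_le] psi_a; exists a.
have ap : a * p < 1.
  rewrite -ltr_pdivlMr// div1r lt_neqAle a_le andbT.
  by apply: contraTneq psi1 => <-; rewrite psi_a ltxx.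
by split=> //; rewrite (subr0_eq psi_a) mulfK// gt_eqF// subr_gt0.
Qed.

Lemma ge0_integral_eq0_powR d (T : measurableType d) (R : realType)
    (mu : {measure set T -> \bar R}) (p : R) (f : T -> R) : p != 0 ->
  measurable_fun setT f -> (forall x, 0 <= f x) -> (\int[mu]_x (f x)%:E = 0)%E ->
  (\int[mu]_x (f x `^ p)%:E = 0)%E.
Proof.
move=> p_neq0 mf f0 int_f.
have abs_int : (\int[mu]_x `|(EFin \o f) x| = 0)%E.
  by rewrite -[RHS]int_f; apply: eq_integral => x _; rewrite /= ger0_norm.
have f_ae : ae_eq mu setT (EFin \o f) (cst 0%E).
  by apply/ae_eq_integral_abs => //; exact/measurable_EFinP.
rewrite -[RHS](integral0 mu setT); apply: ge0_ae_eq_integral => //.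
- by apply/measurable_EFinP; exact: measurable_fun_powR.
- by move=> x _; rewrite lee_fin powR_ge0.
- by apply: filterS f_ae => x /(_ Logic.I) [->] _; rewrite powR0.
Qed.

Lemma Btilde_mean0 d (T : measurableType d) (R : realType) (mu : probability T R)
    (F : nat -> set (set T)) (p Fv : R) : filtration F -> 1 < p ->
  Btilde mu F p Fv 0 = if Fv == 0 then 0%E else -oo%E.
Proof.
move=> filF p1; have p0 : 0 < p by exact: lt_trans p1.
have [->|Fv_neq0] := eqVneq Fv 0; last first.
  rewrite -[RHS]ereal_sup0; congr ereal_sup.
  apply/seteqP; split=> // v [f [fn [[mf f0 int_fp int_f] _ _]]].
  have := ge0_integral_eq0_powR (lt0r_neq0 p0) mf f0 int_f.
  by rewrite int_fp => -[] /eqP; rewrite (negbTE Fv_neq0).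
have pow0 : 0 `^ p = 0 :> R by rewrite powR0// gt_eqF.
apply/eqP; rewrite eq_le; apply/andP; split.
  have a0 : 0 < (2 * p)^-1 by rewrite invr_gt0 mulr_gt0.
  have ap : (2 * p)^-1 * p < 1 by rewrite invfM divfK ?gt_eqF// invf_lt1// ltr1n.
  have := @Btilde_upper _ _ _ mu F p _ 0 0 filF p1 a0 ap (lexx 0).
  by rewrite pow0 !mul0r; apply.
apply: ereal_sup_ubound; exists (cst 0), (fun=> cst 0); split.
- split=> //; last exact: integral0.
  by under eq_integral do rewrite /= pow0; exact: integral0.
- move=> n; split; last exact: finite_measure_integrable_cst.
  split=> //; apply/(G_measurable_EFinP (filtration_sigma filF n)).
  exact: measurable_cst.
- rewrite -[LHS](integral0 mu setT); apply: eq_integral => x _.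
  have -> : maxfun (fun=> cst 0) x = 0%E :> \bar R.
    apply/eqP; rewrite eq_le maxfun_ge0 andbT.
    by apply/maxfun_leP => n; rewrite /= normr0.
  by rewrite poweR_EFin pow0.
Qed.

Lemma Btilde_universal d1 d2 (T1 : measurableType d1) (T2 : measurableType d2)
    (R : realType) (mu1 : probability T1 R) (mu2 : probability T2 R)
    (F1 : nat -> set (set T1)) (F2 : nat -> set (set T2)) (p fv Fv : R) :
  filtration F1 -> inf_refining mu1 F1 -> filtration F2 -> inf_refining mu2 F2 ->
  1 < p -> 0 <= fv -> fv `^ p <= Fv ->
  Btilde mu1 F1 p Fv fv = Btilde mu2 F2 p Fv fv.
Proof.
move=> filF1 irF1 filF2 irF2 p1; rewrite le_eqVlt => /predU1P[<- _|fv0 Fv_ge].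
  by rewrite !Btilde_mean0.
have fvp0 : 0 < fv `^ p by exact: powR_gt0.
have ratio_ge1 : 1 <= Fv / fv `^ p by rewrite ler_pdivlMr// mul1r.
have [a [a0 ap ratioE]] := extremal_ratio_surj p1 ratio_ge1.
have -> : Fv = fv `^ p * ((1 - a) `^ p / (1 - a * p)).
  by rewrite ratioE mulrC divfK// gt_eqF.
by rewrite !Btilde_extremal.
Qed.

(** * The dyadic filtration *)

Section dyadic_index.
Context (R : realType).

(* Negative reals are put into cell 0, which is harmless because the uniform
   probability is carried by [[0, 1]]. *)
Definition dyad_index (m : nat) (x : R) : nat := Num.truncn (2 ^+ m * Num.max x 0).

Let arg_ge0 m x : 0 <= 2 ^+ m * Num.max x 0 :> R.
Proof. by rewrite mulr_ge0 ?exprn_ge0// le_max lexx orbT. Qed.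

Lemma dyad_itv m j :
  dyad m j = `[j%:R / 2 ^+ m, j.+1%:R / 2 ^+ m[%classic :> set R.
Proof. by apply/seteqP; split => x /=; rewrite in_itv. Qed.

Lemma dyad00 : dyad 0 0 = `[0, 1[%classic :> set R.
Proof. by rewrite dyad_itv expr0 !divr1. Qed.

Lemma dyad_indexS m x : dyad_index m x = (dyad_index m.+1 x %/ 2)%N.
Proof.
rewrite /dyad_index exprS -mulrA; set y := 2 ^+ m * _.
have y0 : 0 <= y by exact: arg_ge0.
have y20 : 0 <= 2 * y by rewrite mulr_ge0.
have /andP[] := truncn_itv y20; set z := Num.truncn (2 * y) => z_le lt_z.
apply: truncn_def; apply/andP; split.
  have : ((z %/ 2) * 2)%:R <= z%:R :> R by rewrite ler_nat leq_divM.
  by rewrite natrM => /le_trans/(_ z_le); rewrite mulrC ler_pM2l.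
have : (z.+1)%:R <= ((z %/ 2).+1 * 2)%:R :> R by rewrite ler_nat ltn_ceil.
by rewrite natrM => /(lt_le_trans lt_z); rewrite [X in _ < X]mulrC ltr_pM2l.
Qed.

Lemma dyad_index_div m M x : (m <= M)%N ->
  dyad_index m x = (dyad_index M x %/ 2 ^ (M - m))%N.
Proof.
move=> mM; rewrite -{1}(subKn mM); elim: (M - m)%N (leq_subr m M) => [_|k IHk kM].
  by rewrite subn0 expn0 divn1.
by rewrite expnSr divnMA -IHk ?(ltnW kM)// dyad_indexS subnSK.
Qed.

Lemma dyad_index_lt m x : dyad 0 0 x -> (dyad_index m x < 2 ^ m)%N.
Proof.
rewrite dyad00 /= in_itv/= => /andP[x0 x1]; rewrite -(@ltr_nat R).
have /andP[le_x _] := truncn_itv (arg_ge0 m x); apply: (le_lt_trans le_x).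
by rewrite max_l// natrX gtr_pMr// exprn_gt0.
Qed.

Lemma dyad_index_nat m j : dyad_index m (j%:R / 2 ^+ m) = j.
Proof.
rewrite /dyad_index max_l; last by rewrite divr_ge0// exprn_ge0.
by rewrite mulrC divfK ?gt_eqF ?exprn_gt0// natrK.
Qed.

Lemma dyad_indexP m j x : (j < 2 ^ m)%N ->
  dyad m j x <-> dyad_index m x = j /\ dyad 0 0 x.
Proof.
move=> jm; have m0 : 0 < 2 ^+ m :> R by exact: exprn_gt0.
have index_eq : 0 <= x -> dyad m j x <-> dyad_index m x = j.
  move=> x0; rewrite /dyad /dyad_index /= max_l// ler_pdivrMr// ltr_pdivlMr// mulrC.
  by rewrite -(truncn_eq _ (mulr_ge0 (ltW m0) x0)); split => [/eqP|->].
rewrite dyad00 /= in_itv/=; split=> [xj|[xj /andP[x0 _]]]; last exact/(index_eq x0).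
have /andP[x_ge x_lt] := xj.
have x0 : 0 <= x by apply: le_trans x_ge; rewrite divr_ge0// ltW.
split; [exact/index_eq|rewrite x0/=; apply: (lt_le_trans x_lt)].
by rewrite ler_pdivrMr// mul1r -natrX ler_nat.
Qed.

End dyadic_index.

Lemma sum_double (V : zmodType) (G : nat -> V) N :
  \sum_(j < N * 2) G j = \sum_(j < N) (G (j * 2)%N + G (j * 2).+1).
Proof.
elim: N => [|N IHN]; first by rewrite mul0n !big_ord0.
by rewrite mulSn add2n !big_ord_recr/= IHN addrA.
Qed.

Section dyadic_filtration.
Context (R : realType).
Local Notation RT := (measurableTypeR R).
Local Notation leb := (@lebesgue_measure R).
Local Notation U := (uniform_prob (@ltr01 R)).
Local Notation D := (dyad 0 0 : set RT).

Definition dyad_cell m j : set RT := dyad_index m @^-1` [set j].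

Definition dyadic_filtration (m : nat) : set (set RT) :=
  [set A | exists B : set nat, A = dyad_index m @^-1` B].

Lemma dyad_cellE m j : (j < 2 ^ m)%N -> dyad_cell m j `&` D = dyad m j.
Proof. by move=> jm; apply/seteqP; split=> x /(dyad_indexP _ jm). Qed.

Lemma dyadic_filtration_cell m j : dyadic_filtration m (dyad_cell m j).
Proof. by exists [set j]. Qed.

Lemma measurable_dyad_cell m j : measurable (dyad_cell m j).
Proof.
rewrite (_ : dyad_cell m j = setT `&` (fun x : RT => 2 ^+ m * Num.max x 0) @^-1`
  `[j%:R, j.+1%:R[%classic); last first.
  rewrite setTI; apply/seteqP; split => x;
    rewrite /dyad_cell /= in_itv/= -truncn_eq ?mulr_ge0 ?exprn_ge0 ?le_max ?lexx ?orbT//.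
    by move=> /eqP.
  by move=> /eqP.
suff : measurable_fun setT (fun x : RT => 2 ^+ m * Num.max x 0) by apply.
by apply: measurable_funM => //; exact: measurable_maxr.
Qed.

Lemma dyadic_filtration_measurable m : dyadic_filtration m `<=` measurable.
Proof.
move=> _ [B ->].
rewrite (_ : dyad_index m @^-1` B = \bigcup_(j in B) dyad_cell m j).
  by apply: bigcup_measurable => j _; exact: measurable_dyad_cell.
by apply/seteqP; split => x; [move=> Bx; exists (dyad_index m x)|move=> [j Bj /= ->]].
Qed.

Lemma filtration_dyadic : filtration dyadic_filtration.
Proof.
move=> m; split; last 2 first.
- exact: dyadic_filtration_measurable.
- move=> _ [B ->]; exists [set j | B (j %/ 2)%N].
  by apply/seteqP; split => x /=; rewrite (dyad_indexS m x).
split.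
- by exists set0; rewrite preimage_set0.
- by move=> _ [B ->]; exists (~` B); rewrite setTD preimage_setC.
- move=> A FA; have /choice[B BE] n := FA n; exists (\bigcup_n B n).
  by rewrite preimage_bigcup; apply: eq_bigcupr => n _; rewrite BE.
Qed.

Lemma G_measurable_dyad_index m (g : nat -> \bar R) :
  G_measurable (dyadic_filtration m) (fun x => g (dyad_index m x)).
Proof. by move=> B _; exists (g @^-1` B). Qed.

Lemma measurable_dyad_index m (g : nat -> \bar R) :
  measurable_fun setT (fun x : RT => g (dyad_index m x)).
Proof.
apply: (G_measurableW (@dyadic_filtration_measurable m)).
exact: G_measurable_dyad_index.
Qed.

Lemma G_measurable_dyadicE m (g : RT -> \bar R) : G_measurable (dyadic_filtration m) g ->
  forall x, g x = g ((dyad_index m x)%:R / 2 ^+ m).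
Proof.
move=> Gg x; have [B BE] := Gg [set g x] (emeasurable_set1 _).
have Bx : B (dyad_index m x) by have : (g @^-1` [set g x]) x by []; rewrite BE.
have : (dyad_index m @^-1` B) ((dyad_index m x)%:R / 2 ^+ m : R).
  by rewrite /= dyad_index_nat.
by rewrite -BE /= => ->.
Qed.

Lemma integral_uniform01 (A : set RT) (h : RT -> \bar R) : measurable A ->
  measurable_fun setT h -> (forall x, (0 <= h x)%E) ->
  (\int[U]_(x in A) h x = \int[leb]_(x in A `&` D) h x)%E.
Proof.
move=> mA mh h0; have mhA : measurable_fun setT (h \_ A).
  exact/(measurable_restrictT _ mA)/measurable_funTS.
rewrite integral_mkcond integral_uniform//; last by move=> x; rewrite patchE; case: ifP.
rewrite subr0 invr1 mul1e -integral_itv_bndo_bndc; last exact: measurable_funTS.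
by rewrite -dyad00 setIC [RHS]integral_mkcondr.
Qed.

Lemma integral_dyad_cell m j (h : RT -> \bar R) : (j < 2 ^ m)%N ->
  measurable_fun setT h -> (forall x, (0 <= h x)%E) ->
  (\int[U]_(x in dyad_cell m j) h x = \int[leb]_(x in dyad m j) h x)%E.
Proof.
move=> jm mh h0; rewrite integral_uniform01//; last exact: measurable_dyad_cell.
by rewrite dyad_cellE.
Qed.

Lemma lebesgue_measure_dyad m j : leb (dyad m j) = ((2 ^+ m)^-1)%:E.
Proof.
rewrite dyad_itv lebesgue_measure_itv/= lte_fin.
rewrite ltr_pM2r ?invr_gt0 ?exprn_gt0// ltr_nat ltnSn.
by rewrite -EFinD -mulrBl -natrB// subSnn mul1r.
Qed.

Lemma fine_prob_dyad_cell m j : (j < 2 ^ m)%N -> fine (U (dyad_cell m j)) = (2 ^+ m)^-1.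
Proof.
move=> jm; have mcell := measurable_dyad_cell m j; apply: EFin_inj.
rewrite fine_probK// -[LHS]mul1e -integral_cst// integral_dyad_cell//.
rewrite integral_cst; last by rewrite dyad_itv.
by rewrite mul1e; exact: lebesgue_measure_dyad.
Qed.

Lemma integral_dyad_cells m M (B : set nat) (h : RT -> \bar R) : (m <= M)%N ->
  measurable_fun setT h -> (forall x, (0 <= h x)%E) ->
  (\int[U]_(x in dyad_index m @^-1` B) h x =
   \sum_(j < 2 ^ M | (j %/ 2 ^ (M - m))%N \in B) \int[U]_(x in dyad_cell M j) h x)%E.
Proof.
move=> mM mh h0; rewrite integral_uniform01//; last first.
  by apply: (@dyadic_filtration_measurable m); exists B.
pose s := [seq j : 'I_(2 ^ M) <- index_enum _ | (j %/ 2 ^ (M - m))%N \in B].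
have -> : dyad_index m @^-1` B `&` D =
    \big[setU/set0]_(j <- s) (dyad_cell M j `&` D).
  rewrite -bigcup_seq; apply/seteqP; split=> [x [Bx Dx]|x [j /= + [xj Dx]]].
    exists (Ordinal (dyad_index_lt M Dx)) => //=.
    by rewrite mem_filter mem_index_enum andbT/= -dyad_index_div// mem_set.
  rewrite mem_filter => /andP[/set_mem Bj _]; split => //.
  by rewrite /= (dyad_index_div _ mM) xj.
rewrite ge0_integral_bigsetU//.
- rewrite big_filter; apply: eq_bigr => j _.
  by rewrite integral_uniform01//; exact: measurable_dyad_cell.
- by move=> j; rewrite dyad_cellE// dyad_itv.
- exact/filter_uniq/index_enum_uniq.
- by move=> i j _ _ [x [[xi _] [xj _]]]; exact: val_inj (etrans (esym xi) xj).
- exact: measurable_funTS.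
Qed.

Lemma integral_dyad_index m M (B : set nat) (g : nat -> \bar R) : (m <= M)%N ->
  (forall j, (0 <= g j)%E) ->
  (\int[U]_(x in dyad_index m @^-1` B) g (dyad_index M x) =
   \sum_(j < 2 ^ M | (j %/ 2 ^ (M - m))%N \in B) g j * ((2 ^+ M)^-1)%:E)%E.
Proof.
move=> mM g0; rewrite (integral_dyad_cells B mM)//; last exact: measurable_dyad_index.
apply: eq_bigr => j _; have mcell := measurable_dyad_cell M j.
rewrite -(fine_prob_dyad_cell (ltn_ord j)) fine_probK// -integral_cst//.
by apply: eq_integral => x /set_mem ->.
Qed.

Lemma integral_dyad_indexT M (g : nat -> \bar R) : (forall j, (0 <= g j)%E) ->
  (\int[U]_x g (dyad_index M x) = \sum_(j < 2 ^ M) g j * ((2 ^+ M)^-1)%:E)%E.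
Proof.
move=> g0; rewrite -(preimage_setT (@dyad_index R M)) (integral_dyad_index setT (leqnn M))//.
by apply: eq_bigl => j; rewrite in_setT.
Qed.

Lemma fine_prob_dyad_index m M (B : set nat) : (m <= M)%N ->
  fine (U (dyad_index m @^-1` B)) =
  \sum_(j < 2 ^ M | (j %/ 2 ^ (M - m))%N \in B) (2 ^+ M)^-1.
Proof.
move=> mM; have mB : measurable (dyad_index m @^-1` B : set RT).
  by apply: (@dyadic_filtration_measurable m); exists B.
apply: EFin_inj; rewrite -sumEFin fine_probK// -[LHS]mul1e -integral_cst//.
rewrite (integral_dyad_index B (g := cst 1%E) mM)//.
by apply: eq_bigr => j _; rewrite mul1e.
Qed.

Lemma dyadic_inf_refining : inf_refining U dyadic_filtration.
Proof.
apply: (halving_inf_refining filtration_dyadic) => n.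
exists (dyad_index n.+1 @^-1` [set j | ~~ odd j]) => [|_ [C ->]]; first by eexists.
have -> : dyad_index n.+1 @^-1` [set j | ~~ odd j] `&` dyad_index n @^-1` C =
    dyad_index n.+1 @^-1` [set j | ~~ odd j /\ C (j %/ 2)%N] :> set RT.
  by apply/seteqP; split => x /=; rewrite (dyad_indexS n x).
rewrite !(@fine_prob_dyad_index _ n.+1)// subnn expn0 subSnn expn1.
rewrite big_mkcond [in RHS]big_mkcond/= mulr_sumr expnSr.
pose c : R := (2 ^+ n.+1)^-1.
rewrite (sum_double (fun j => if (j %/ 1)%N \in _ then c else 0)).
rewrite [RHS](sum_double (fun j => 2^-1 * if (j %/ 2)%N \in C then c else 0)).
apply: eq_bigr => j _.
have odd_div : ((j * 2).+1 %/ 2 = j)%N by rewrite -addn1 divnMDl// addn0.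
rewrite !divn1 mulnK// odd_div [X in _ + X]ifF; last first.
  by apply/negP => /set_mem[/=]; rewrite oddM andbF.
rewrite addr0 -mulrDl (_ : 2^-1 + 2^-1 = 1) ?mul1r; last by field.
congr (if _ then _ else _); apply/idP/idP => [/set_mem[_]|/set_mem Cj].
  by rewrite mulnK// => Cj; exact: mem_set.
by apply: mem_set; rewrite /= oddM andbF mulnK.
Qed.

End dyadic_filtration.

Section dyadic_correspondence.
Context (R : realType).
Local Notation RT := (measurableTypeR R).
Local Notation leb := (@lebesgue_measure R).
Local Notation U := (uniform_prob (@ltr01 R)).
Local Notation F := (@dyadic_filtration R).
Local Notation D := (dyad 0 0 : set RT).
Implicit Types (alpha avg : nat -> nat -> R) (f : RT -> R).

Let filF : filtration F := @filtration_dyadic R.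

Definition dyadic_density alpha n (x : RT) : R := 2 ^+ n * alpha n (dyad_index n x).

Lemma nneg_adapted_density alpha : (forall m j, 0 <= alpha m j) ->
  nneg_adapted F (dyadic_density alpha).
Proof.
move=> al0; split=> [n x|n]; first by rewrite mulr_ge0// exprn_ge0.
exact: (G_measurable_dyad_index n (fun j => (2 ^+ n * alpha n j)%:E)).
Qed.

Lemma nneg_adapted_densityE u : nneg_adapted F u ->
  exists2 alpha, (forall m j, 0 <= alpha m j) & u = dyadic_density alpha.
Proof.
move=> [u0 Gu]; exists (fun m j => u m (j%:R / 2 ^+ m) / 2 ^+ m) => [m j|].
  by rewrite divr_ge0// exprn_ge0.
apply/funext => m; apply/funext => x; apply: EFin_inj.
rewrite -[LHS]/((EFin \o u m) x) (G_measurable_dyadicE (Gu m)) /dyadic_density /=.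
by rewrite mulrCA divff ?mulr1// gt_eqF// exprn_gt0.
Qed.

Section carleson_density.
Variable alpha : nat -> nat -> R.
Hypothesis al0 : forall m j, 0 <= alpha m j.

Lemma integral_density_tail n (B : set nat) :
  (\int[U]_(x in dyad_index n @^-1` B) (\sum_(n <= k <oo) (dyadic_density alpha k x)%:E) =
   \sum_(n <= k <oo) \sum_(j < 2 ^ k | (j %/ 2 ^ (k - n))%N \in B) (alpha k j)%:E)%E.
Proof.
have [density0 _] := nneg_adapted_density al0.
rewrite ge0_integral_nneseries_from; first last.
- by move=> k x; rewrite lee_fin.
- by move=> k; exact: (measurable_dyad_index k (fun j => (2 ^+ k * alpha k j)%:E)).
- by apply: (@dyadic_filtration_measurable _ n); exists B.
congr (limn _); apply/funext => N; apply: eq_big_nat => k /andP[nk _].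
rewrite (integral_dyad_index B (g := fun j => (2 ^+ k * alpha k j)%:E) nk).
  apply: eq_bigr => j _; rewrite -EFinM; congr EFin.
  by field; rewrite gt_eqF// exprn_gt0.
by move=> j; rewrite lee_fin mulr_ge0// exprn_ge0.
Qed.

Lemma integral_density_sum :
  (\int[U]_x (\sum_(k <oo) (dyadic_density alpha k x)%:E) =
   \sum_(m <oo) \sum_(j < 2 ^ m) (alpha m j)%:E)%E.
Proof.
rewrite -(preimage_setT (@dyad_index R 0)) integral_density_tail.
by apply: eq_eseriesr => k _; apply: eq_bigl => j; rewrite in_setT.
Qed.

Lemma integral_density_dsub m j :
  (\int[U]_(x in dyad_cell m j) (\sum_(m <= k <oo) (dyadic_density alpha k x)%:E) =
   dsub alpha m j)%E.
Proof.
rewrite integral_density_tail; congr (limn _); apply/funext => N; apply: eq_bigr => k _.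
by apply: eq_bigl => i; rewrite in_set1.
Qed.

Lemma carleson_densityP C : 0 <= C -> carleson U F C (dyadic_density alpha) <->
  forall m j, (j < 2 ^ m)%N -> (dsub alpha m j <= (C / 2 ^+ m)%:E)%E.
Proof.
move=> C0; have al_adapted := nneg_adapted_density al0.
apply: (iff_trans (carlesonP U filF C0 al_adapted)); split=> [tail_le m j jm|dsub_le n].
  rewrite -integral_density_dsub -(fine_prob_dyad_cell R jm); apply: tail_le.
  exact: dyadic_filtration_cell.
move=> _ [B ->]; rewrite (integral_dyad_cells B (leqnn n)); first last.
- by move=> x; apply: nneseries_ge0 => k _ _; rewrite lee_fin; case: al_adapted.
- apply: measurable_nneseries_from => k; last by move=> x; rewrite lee_fin; case: al_adapted.
  exact: (measurable_dyad_index k (fun j => (2 ^+ k * alpha k j)%:E)).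
rewrite (fine_prob_dyad_index R B (leqnn n)) mulr_sumr -sumEFin.
by apply: lee_sum => j _; rewrite integral_density_dsub dsub_le.
Qed.

End carleson_density.

Definition dyadic_average f avg : Prop :=
  forall m j, (j < 2 ^ m)%N -> dyavg f m j = (avg m j)%:E.

Lemma integral_density_powR alpha f avg p : (forall m j, 0 <= alpha m j) ->
  dyadic_average f avg ->
  (\int[U]_x (\sum_(k <oo)
      (dyadic_density alpha k x * avg k (dyad_index k x) `^ p)%:E) =
   \sum_(k <oo) \sum_(j < 2 ^ k) (alpha k j)%:E * dyavg f k j `^ p)%E.
Proof.
move=> al0 avgE; pose term k j := (2 ^+ k * alpha k j * avg k j `^ p)%:E.
have term0 k j : (0 <= term k j)%E by rewrite lee_fin !mulr_ge0 ?exprn_ge0 ?powR_ge0.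
rewrite integral_nneseries//; last 2 first.
- by move=> k; exact: (measurable_dyad_index k (term k)).
- by move=> k x _; exact: (term0 k (dyad_index k x)).
apply: eq_eseriesr => k _; rewrite (integral_dyad_indexT k (g := term k))//.
apply: eq_bigr => j _; rewrite avgE// poweR_EFin -!EFinM; congr EFin.
by field; rewrite gt_eqF// exprn_gt0.
Qed.

Section averages.
Variable f : RT -> R.
Hypotheses (mf : measurable_fun setT f) (f0 : forall x, 0 <= f x).

Let mfE : measurable_fun setT (EFin \o f). Proof. exact/measurable_EFinP. Qed.
Let f0E x : (0 <= (EFin \o f) x)%E. Proof. by rewrite lee_fin. Qed.

Let dyavg_cell m j : (j < 2 ^ m)%N ->
  dyavg f m j = ((2 ^+ m)%:E * \int[U]_(x in dyad_cell m j) (f x)%:E)%E.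
Proof. by move=> jm; rewrite integral_dyad_cell. Qed.

Let integral_cell m j : (j < 2 ^ m)%N ->
  (\int[U]_(x in dyad_cell m j) (f x)%:E = dyavg f m j * ((2 ^+ m)^-1)%:E)%E.
Proof.
by move=> jm; rewrite dyavg_cell// muleAC -EFinM divff ?mul1e// gt_eqF// exprn_gt0.
Qed.

Lemma exists_dyadic_average : U.-integrable setT (EFin \o f) ->
  exists2 avg, dyadic_average f avg & forall m j, 0 <= avg m j.
Proof.
move=> fi; exists (fun m j => fine (dyavg f m j)) => m j; last first.
  by rewrite fine_ge0// mule_ge0 ?lee_fin ?exprn_ge0//; apply: integral_ge0 => x _; exact: f0E.
move=> jm; have mcell := measurable_dyad_cell m j.
rewrite fineK// dyavg_cell// fin_numM//; apply: integrable_fin_num => //.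
exact: integrableS fi.
Qed.

Lemma cond_exps_dyadic_average avg : U.-integrable setT (EFin \o f) ->
  dyadic_average f avg -> (forall m j, 0 <= avg m j) ->
  cond_exps U F f (fun m x => avg m (dyad_index m x)).
Proof.
move=> fi avgE avg0 m; have avg0E j : (0 <= (avg m j)%:E)%E by rewrite lee_fin.
have avg_condexp : is_condexp U (F m) (EFin \o f) (fun x => (avg m (dyad_index m x))%:E).
  split=> [|_ [B ->]]; first exact: (G_measurable_dyad_index m (fun j => (avg m j)%:E)).
  rewrite (integral_dyad_index B (g := fun j => (avg m j)%:E) (leqnn m))//.
  rewrite (integral_dyad_cells B (leqnn m))//.
  by apply: eq_bigr => j _; rewrite integral_cell// avgE.
split=> //; apply: ge0_integrable => //.
  by apply/measurable_EFinP; exact: (measurable_dyad_index m (fun j => (avg m j)%:E)).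
have [_ ->] := avg_condexp; last by exists setT; rewrite preimage_setT.
exact: integrable_lty fi.
Qed.

Lemma dyadic_average_cond_exps fn : cond_exps U F f fn ->
  exists2 avg, dyadic_average f avg & forall m x, fn m x = avg m (dyad_index m x).
Proof.
move=> fnE; have constE m x : fn m x = fn m ((dyad_index m x)%:R / 2 ^+ m).
  by apply: EFin_inj; have [[Gfn _] _] := fnE m; exact: (G_measurable_dyadicE Gfn).
exists (fun m j => fn m (j%:R / 2 ^+ m)) => // m j jm.
have [[_ fnf] _] := fnE m; have mcell := measurable_dyad_cell m j.
rewrite dyavg_cell// -[X in (_ * X)%E]/(\int[U]_(x in _) (EFin \o f) x)%E.
rewrite -fnf; last exact: dyadic_filtration_cell.
rewrite (@eq_integral _ _ _ U _ (cst (fn m (j%:R / 2 ^+ m))%:E)); last first.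
  by move=> x /set_mem xj; rewrite /= constE xj.
rewrite integral_cst_fine// fine_prob_dyad_cell// -EFinM; congr EFin.
by rewrite mulrCA divff ?mulr1// gt_eqF// exprn_gt0.
Qed.

End averages.

Lemma has_moments_unit p Fv fv f :
  measurable_fun setT f -> (forall x, 0 <= f x) ->
  has_moments U p Fv fv f <->
  (\int[leb]_(x in D) (f x `^ p)%:E = Fv%:E)%E /\ (\int[leb]_(x in D) (f x)%:E = fv%:E)%E.
Proof.
move=> mf f0; have integral_unit (q : RT -> R) :
    measurable_fun setT q -> (forall x, 0 <= q x) ->
    (\int[leb]_(x in D) (q x)%:E = \int[U]_x (q x)%:E)%E.
  by move=> mq q0; rewrite integral_uniform01 ?setTI//; exact/measurable_EFinP.
rewrite (integral_unit _ mf f0) (integral_unit (fun x => f x `^ p)); first last.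
- by move=> x; exact: powR_ge0.
- exact: measurable_fun_powR.
by split=> [[_ _ -> ->]|[int_fp int_f]]; split.
Qed.

Lemma dyavg_patch f m j : (j < 2 ^ m)%N -> dyavg (f \_ D) m j = dyavg f m j.
Proof.
move=> jm; congr (_ * _)%E; apply: eq_integral => x /set_mem /(dyad_indexP _ jm)[_ Dx].
by rewrite patchE mem_set.
Qed.

Section equality.
Variables (p Fv fv M C : R).
Hypothesis C0 : 0 <= C.

Lemma Bdyadic_le_Bmart : (Bdyadic p Fv fv M C <= Bmart U F p Fv fv M C)%E.
Proof.
apply: ge_ereal_sup => _ [f [alpha [[mf f0 int_fp int_f] al0 al_sum al_dsub ->]]].
have mD : measurable D by rewrite dyad00.
have patchD x : x \in D -> (f \_ D) x = f x by move=> xD; rewrite patchE xD.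
have mfD : measurable_fun setT (f \_ D) by exact/(measurable_restrictT _ mD).
have fD0 x : 0 <= (f \_ D) x by rewrite patchE; case: ifP => // /set_mem; exact: f0.
have moments : has_moments U p Fv fv (f \_ D).
  apply/(has_moments_unit p Fv fv mfD fD0); split.
    by rewrite -int_fp; apply: eq_integral => x /patchD ->.
  by rewrite -int_f; apply: eq_integral => x /patchD ->.
have [_ _ _ int_fD] := moments.
have fDi : U.-integrable setT (EFin \o (f \_ D)).
  by apply: ge0_integrable => //; rewrite int_fD ltry.
have [avg avgE avg0] := exists_dyadic_average mfD fD0 fDi.
have [? ? ? ?] := moments; have density_adapted := nneg_adapted_density al0.
apply: ereal_sup_ubound; exists (f \_ D), (fun m x => avg m (dyad_index m x)).
exists (dyadic_density alpha); split=> //.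
- by split=> //; exact: cond_exps_dyadic_average.
- exact/carleson_densityP.
- by rewrite integral_density_sum.
- rewrite (integral_density_powR _ al0 avgE); apply: eq_eseriesr => m _.
  by apply: eq_bigr => j _; rewrite dyavg_patch.
Qed.

Lemma Bmart_le_Bdyadic : (Bmart U F p Fv fv M C <= Bdyadic p Fv fv M C)%E.
Proof.
apply: ge_ereal_sup.
move=> _ [f [fn [al [[mf f0 int_fp int_f fnE] al_adapted al_carleson al_sum ->]]]].
have [alpha al0 alE] := nneg_adapted_densityE al_adapted; subst al.
have [avg avgE fn_avg] := dyadic_average_cond_exps mf f0 fnE.
have [|int_fpD int_fD] := (has_moments_unit p Fv fv mf f0).1; first by split.
apply: ereal_sup_ubound; exists f, alpha; split=> //.
- by split=> //; exact: measurable_funTS.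
- by rewrite -integral_density_sum.
- exact/carleson_densityP.
- rewrite -(integral_density_powR _ al0 avgE); apply: eq_integral => x _.
  by apply: eq_eseriesr => k _; rewrite fn_avg.
Qed.

Lemma Bdyadic_eq_Bmart : Bdyadic p Fv fv M C = Bmart U F p Fv fv M C.
Proof. by apply/eqP; rewrite eq_le Bdyadic_le_Bmart Bmart_le_Bdyadic. Qed.

End equality.

End dyadic_correspondence.

Unset Implicit Arguments.

Theorem theoremB (R : realType) (d : measure_display) (T : measurableType d)
  (mu : probability T R) (F : nat -> set (set T)) (p : R) :
  1 < p -> filtration F ->
  forall Fv fv : R, 0 <= fv -> fv `^ p <= Fv ->
  (Btilde mu F p Fv fv <= Bmart mu F p Fv fv 1 1)%E /\
  (inf_refining mu F ->
     Btilde mu F p Fv fv = Bmart mu F p Fv fv 1 1 /\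
     Bmart mu F p Fv fv 1 1 = Bdyadic p Fv fv 1 1).
Proof.
move=> p1 filF Fv fv fv0 FvP; have p0 : 0 < p by exact: lt_trans p1.
split=> [|irF]; first exact: Btilde_le_Bmart.
split; first exact: Btilde_eq_Bmart.
have filD := @filtration_dyadic R.
rewrite (Bdyadic_eq_Bmart p Fv fv 1 ler01) -!Btilde_eq_Bmart//.
exact: (Btilde_universal filF irF filD (@dyadic_inf_refining R)).
Qed.
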